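(* Let $n\ge1$ and $u\in\mathfrak{S}_n$. The normal fan of the Bruhat interval polytope $\mathsf{Q}_{u_{\mathsf{t}},\,u_{\mathsf{t}}s(n,1)}$ is isomorphic to the fan $\Sigma_{\psi(w_0uw_0)}$ associated with the triangulation $\psi(w_0uw_0)$ of the convex $(n+2)$-gon $\mathsf{P}_{n+2}$, where $w_0$ denotes the longest element in $\mathfrak{S}_n$.
   Context: Triangulations. Let $\mathsf{P}_{n+2}$ be a convex $(n+2)$-gon with vertices labelled $0,1,\dots,n+1$ in counterclockwise order. A triangulation $T$ of $\mathsf{P}_{n+2}$ is a decomposition into $n$ triangles by $n-1$ diagonals not crossing in their interiors; $T$ is also regarded as the set of all edges of these triangles (sides and chosen diagonals). Put $e=\{0,n+1\}$, the distinguished edge. Left and right trees. Define $F\colon T\setminus\{e\}\to\{\mathsf{L},\mathsf{R}\}$ recursively: for a triangulated polygon with distinguished edge $g$ (starting with $\mathsf{P}_{n+2}$ and $g=e$), the unique triangle containing $g$ has two other edges $f_{\mathsf{L}}(g),f_{\mathsf{R}}(g)$, named so that $f_{\mathsf{L}}(g),f_{\mathsf{R}}(g),g$ are placed counterclockwise; set $F(f_{\mathsf{L}}(g))=\mathsf{L}$, $F(f_{\mathsf{R}}(g))=\mathsf{R}$. Removing $g$ leaves two triangulated polygons (possibly single edges) with one common vertex and with distinguished edges $f_{\mathsf{L}}(g)$ and $f_{\mathsf{R}}(g)$; repeat for each of them that is not a single edge. The left tree $\mathcal{T}_T^{\mathsf{L}}$ has vertex set $\{0,\dots,n\}$, root $0$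 and edge set $F^{-1}(\mathsf{L})$; the right tree $\mathcal{T}_T^{\mathsf{R}}$ has vertex set $\{1,\dots,n+1\}$, root $n+1$ and edge set $F^{-1}(\mathsf{R})$. For each $1\le k\le n$ there is exactly one edge $\{k_{\mathsf{L}},k\}$ of $\mathcal{T}_T^{\mathsf{L}}$ with $k_{\mathsf{L}}<k$ and exactly one edge $\{k,k_{\mathsf{R}}\}$ of $\mathcal{T}_T^{\mathsf{R}}$ with $k<k_{\mathsf{R}}$; this defines $k_{\mathsf{L}},k_{\mathsf{R}}$. Fan. Let $M=\{x\in\mathbb{Z}^{n+1}\mid \sum x_i=0\}$ and $N=\mathbb{Z}^{n+1}/\mathbb{Z}(1,\dots,1)$, dual to $M$ via the dot product. Let $\varpi_i\in N$ be the image of $\sum_{k=1}^i e_k$ ($0\le i\le n+1$), so $\varpi_0=\varpi_{n+1}=0$. Put $\mathbf{v}_k=\varpi_k-\varpi_{k_{\mathsf{R}}}$ and $\mathbf{w}_k=\varpi_{k_{\mathsf{L}}}-\varpi_k$ for $k\in[n]=\{1,\dots,n\}$. $\Sigma_T$ is the complete non-singular fan in $N\otimes\mathbb{R}$ consisting of the cones $\operatorname{Cone}(Q)$ for subsets $Q\subset\{\mathbf{v}_k,\mathbf{w}_k\mid k\in[n]\}$ with $\{\mathbf{v}_i,\mathbf{w}_i\}\not\subset Q$ for all $i\in[n]$. Two fans are isomorphic if there is an isomorphism of the underlying lattices that induces a bijection between their cones. The map $\psi$. A binary tree is either empty or has a root, a left subtree and a right subtree, both binary trees. For a triangulation $T$,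 the binary tree $\mathcal{B}_T$ has the triangles of $T$ as vertices, the triangle containing $e$ as root, and the left (right) child of a triangle with distinguished edge $g$ is the other triangle containing $f_{\mathsf{L}}(g)$ (respectively $f_{\mathsf{R}}(g)$), if any. The map $T\mapsto\mathcal{B}_T$ is a bijection from triangulations of $\mathsf{P}_{n+2}$ to binary trees with $n$ vertices, and we identify the two sets through it. For $u\in\mathfrak{S}_n$ in one-line notation $u(1)\cdots u(n)$, the binary tree $\psi(u)$ is defined recursively: if $u(p)$ is the smallest entry of the sequence, it gives the root, the left subtree is the tree obtained in the same way from $u(1)\cdots u(p-1)$, and the right subtree is obtained in the same way from $u(p+1)\cdots u(n)$ (an empty sequence gives the empty tree). Bruhat interval polytopes. $s_i\in\mathfrak{S}_{n+1}$ is the transposition of $i,i+1$, and $s(n,1)=s_ns_{n-1}\cdots s_1$; products of permutations are compositions of maps, so $us(n,1)$ has one-line notation $u(n+1)\,u(1)\cdots u(n)$ for $u\in\mathfrak{S}_{n+1}$. For $u\in\mathfrak{S}_n$, $u_{\mathsf{t}}\in\mathfrak{S}_{n+1}$ is given by $u_{\mathsf{t}}(i)=u(i)$ for $1\le i\le n$ and $u_{\mathsf{t}}(n+1)=n+1$. For $v\le w$ in the Bruhat order on $\mathfrak{S}_{n+1}$, $\mathsf{Q}_{v,w}$ is the convex hull in $\mathbb{R}^{n+1}$ of the points $(z(1),\dots,z(n+1))$ with $v\le z\le w$. Normal fan. The normal fan is taken with inward normals: it is the collection of cones $\sigma_E=\{x\in N\otimes\mathbb{R}\mid \langle x,y-p\rangle\ge0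 \text{ for all } y\in\mathsf{Q}_{v,w},\ p\in E\}$ for nonempty faces $E$ of $\mathsf{Q}_{v,w}$ (the polytope lies in a hyperplane where the sum of coordinates is constant, so $y-p\in M\otimes\mathbb{R}$). *)

(* Defs.v *)
From HB Require Import structures.
From mathcomp Require Import all_fingroup all_boot all_order all_algebra.
From mathcomp Require Import boolp classical_sets functions reals.
Set Implicit Arguments.
Unset Strict Implicit.
Unset Printing Implicit Defensive.
Import Order.TTheory GRing.Theory Num.Theory.
Local Open Scope ring_scope.
Local Open Scope quotient_scope.
Local Open Scope classical_set_scope.

(* [cquot R n] is the quotient R^(n+1) / R(1,...,1), used with [R := int] for the
   lattice N and with a [realType] for the real vector space N (x) R. *)

Section ConstQuotient.
Variables (R : nzRingType) (n : nat).

Definition consteqv (x y : 'rV[R]_n.+1) : bool :=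
  x - y == const_mx ((x - y) 0 0).

Lemma consteqvP (x y : 'rV[R]_n.+1) :
  reflect (exists t : R, x = y + const_mx t) (consteqv x y).
Proof.
apply: (iffP eqP) => [e|[t ->]].
  by exists ((x - y) 0 0); rewrite -e addrC subrK.
by apply/rowP => i; rewrite !mxE ![_ + t - _]addrAC !subrr.
Qed.

Lemma consteqv_is_equiv : equiv_class_of consteqv.
Proof.
split=> [x|x y|y x z].
- by apply/consteqvP; exists 0; rewrite raddf0 addr0.
- apply/consteqvP/consteqvP => -[t ->]; exists (- t);
    by rewrite raddfN /= addrK.
- move=> /consteqvP[t ->] /consteqvP[s ->]; apply/consteqvP; exists (s + t).
  by rewrite raddfD /= addrA.
Qed.

Canonical consteqv_equiv := EquivRelPack consteqv_is_equiv.

Definition cquot := {eq_quot consteqv}.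

HB.instance Definition _ := Choice.on cquot.
HB.instance Definition _ := EqQuotient.on cquot.

Definition cls (x : 'rV[R]_n.+1) : cquot := \pi_cquot x.

Lemma cls_repr (x : cquot) : cls (repr x) = x.
Proof. exact: reprK. Qed.

Lemma cquot_eqP (x y : 'rV[R]_n.+1) :
  cls x = cls y <-> exists t : R, x = y + const_mx t.
Proof.
split=> [/eqP|e]; first by rewrite eqmodE => /consteqvP.
by apply/eqP; rewrite eqmodE; apply/consteqvP.
Qed.

Lemma repr_cquot (x : 'rV[R]_n.+1) :
  exists t : R, repr (cls x) = x + const_mx t.
Proof. by apply/cquot_eqP; exact: cls_repr. Qed.

Definition czero : cquot := cls 0.
Definition copp (x : cquot) : cquot := cls (- repr x).
Definition cadd (x y : cquot) : cquot := cls (repr x + repr y).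
Definition cscale (a : R) (x : cquot) : cquot := cls (a *: repr x).

Lemma copp_cls x : copp (cls x) = cls (- x).
Proof.
apply/cquot_eqP; have [t ->] := repr_cquot x.
by exists (- t); rewrite raddfN opprD.
Qed.

Lemma cadd_cls x y : cadd (cls x) (cls y) = cls (x + y).
Proof.
apply/cquot_eqP; have [t ->] := repr_cquot x; have [s ->] := repr_cquot y.
by exists (t + s); rewrite raddfD /= addrACA.
Qed.

Lemma cscale_cls a x : cscale a (cls x) = cls (a *: x).
Proof.
apply/cquot_eqP; have [t ->] := repr_cquot x; exists (a * t).
by rewrite scalerDr; congr (_ + _); apply/matrixP => i j; rewrite !mxE.
Qed.

Lemma cquot_ind (P : cquot -> Prop) : (forall x, P (cls x)) -> forall x, P x.
Proof. by move=> H x; rewrite -[x]cls_repr. Qed.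

Lemma caddA : associative cadd.
Proof.
by do 3![elim/cquot_ind => ?]; rewrite !cadd_cls addrA.
Qed.

Lemma caddC : commutative cadd.
Proof. by do 2![elim/cquot_ind => ?]; rewrite !cadd_cls addrC. Qed.

Lemma cadd0 : left_id czero cadd.
Proof. by elim/cquot_ind => ?; rewrite cadd_cls add0r. Qed.

Lemma caddN : left_inverse czero copp cadd.
Proof. by elim/cquot_ind => ?; rewrite copp_cls cadd_cls addNr. Qed.

HB.instance Definition _ := GRing.isZmodule.Build cquot caddA caddC cadd0 caddN.

Lemma cscaleA a b x : cscale a (cscale b x) = cscale (a * b) x.
Proof. by elim/cquot_ind: x => x; rewrite !cscale_cls scalerA. Qed.

Lemma cscale1 : left_id 1 cscale.
Proof. by elim/cquot_ind => x; rewrite cscale_cls scale1r. Qed.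

Lemma cscaleDr : right_distributive cscale +%R.
Proof.
move=> a; do 2![elim/cquot_ind => ?].
by rewrite [LHS](congr1 _ (cadd_cls _ _)) !cscale_cls [RHS]cadd_cls scalerDr.
Qed.

Lemma cscaleDl x : {morph cscale^~ x : a b / a + b}.
Proof.
by move=> a b; elim/cquot_ind: x => x; rewrite !cscale_cls [RHS]cadd_cls scalerDl.
Qed.

HB.instance Definition _ := GRing.Zmodule_isLmodule.Build R cquot
  cscaleA cscale1 cscaleDr cscaleDl.

Lemma cls_is_zmod_morphism : zmod_morphism cls.
Proof.
by move=> x y; rewrite [RHS](congr1 _ (copp_cls _)) [RHS]cadd_cls.
Qed.

HB.instance Definition _ :=
  GRing.isZmodMorphism.Build 'rV[R]_n.+1 cquot cls cls_is_zmod_morphism.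

End ConstQuotient.

Notation latN n := (cquot int n) (only parsing).
Notation spaceN R n := (cquot R n) (only parsing).

Definition latN_emb (R : realType) (n : nat) (x : latN n) : spaceN R n :=
  cls (map_mx intr (repr x)).

Arguments latN_emb R {n} x.

Lemma latN_emb_cls (R : realType) (n : nat) (x : 'rV[int]_n.+1) :
  latN_emb R (cls x) = cls (map_mx intr x).
Proof.
rewrite /latN_emb; apply/cquot_eqP; have [t ->] := repr_cquot x.
by exists t%:~R; apply/rowP => i; rewrite !mxE rmorphD.
Qed.

Definition dot (R : realType) (m : nat) (x y : 'rV[R]_m) : R :=
  \sum_i x 0 i * y 0 i.

(* The pairing of N (x) R with M (x) R; it does not depend on the chosen
   representative of [x] when the coordinates of [y] sum to 0. *)
Definition pairing (R : realType) (n : nat) (x : spaceN R n)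
  (y : 'rV[R]_n.+1) : R := dot (repr x) y.

Lemma pairing_cls (R : realType) (n : nat) (x y : 'rV[R]_n.+1) :
  \sum_i y 0 i = 0 -> pairing (cls x) y = dot x y.
Proof.
move=> y0; rewrite /pairing /dot; have [t ->] := repr_cquot x.
under eq_bigr do rewrite !mxE mulrDl.
by rewrite big_split /= -mulr_sumr y0 mulr0 addr0.
Qed.

Definition cone_of (R : realType) (V : lmodType R) (S : set V) : set V :=
  [set x | exists m (q : 'I_m -> V) (c : 'I_m -> R),
    [/\ forall i, S (q i), forall i, 0 <= c i & x = \sum_i c i *: q i]].

Definition conv_hull (R : realType) (V : lmodType R) (S : set V) : set V :=
  [set x | exists m (q : 'I_m -> V) (c : 'I_m -> R),
    [/\ forall i, S (q i), forall i, 0 <= c i, \sum_i c i = 1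
      & x = \sum_i c i *: q i]].

(* Faces cut out by supporting hyperplanes; [a = 0] gives [P] itself. *)
Definition is_face (R : realType) (m : nat) (P E : set 'rV[R]_m) : Prop :=
  exists (a : 'rV[R]_m) (b : R),
    (forall y, P y -> b <= dot a y) /\ E = [set y | P y /\ dot a y = b].

Definition normal_cone (R : realType) (n : nat) (P E : set 'rV[R]_n.+1) :
    set (spaceN R n) :=
  [set x | forall y p, P y -> E p -> 0 <= pairing x (y - p)].

(* The normal fan (inward normals) of a polytope lying in a hyperplane on which
   the sum of the coordinates is constant. *)
Definition normal_fan (R : realType) (n : nat) (P : set 'rV[R]_n.+1) :
    set (set (spaceN R n)) :=
  [set C | exists E, [/\ is_face P E, E !=set0 & C = normal_cone P E]].

(* [phiR] is the real linear extension of the lattice isomorphism [phi]. *)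
Definition fan_isomorphic (R : realType) (n : nat)
    (F G : set (set (spaceN R n))) : Prop :=
  exists (phi : {additive latN n -> latN n})
         (phiR : {linear spaceN R n -> spaceN R n}),
    [/\ bijective phi,
        forall x, phiR (latN_emb R x) = latN_emb R (phi x)
      & set_bij F G (fun C => phiR @` C)].

Section Triangulations.
Variable n : nat.

Definition vertex := 'I_n.+2.

(* An edge {i, j} with i < j is the pair (i, j). *)
Definition edge := (vertex * vertex)%type.

Definition root_edge : edge := (ord0, ord_max).

Definition polygon_sides : {set edge} :=
  [set f : edge | (f.2 == f.1.+1 :> nat) || (f == root_edge)]%SET.

Definition crossing (f g : edge) : bool := (f.1 < g.1 < f.2)%N && (f.2 < g.2)%N.

Definition is_triangulation (T : {set edge}) : bool :=
  [&& [forall f in T, (f.1 < f.2)%N],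
      polygon_sides \subset T,
      [forall f in T, forall g in T, ~~ crossing f g]
    & #|(T :\: polygon_sides)%SET| == n.-1].

Definition triangulation := {T : {set edge} | is_triangulation T}.

End Triangulations.

Inductive bintree (A : Type) :=
  | Empty
  | Node (l : bintree A) (x : A) (r : bintree A).
Arguments Empty {A}.

Fixpoint shape (A : Type) (t : bintree A) : bintree unit :=
  if t is Node l _ r then Node (shape l) tt (shape r) else Empty.

Fixpoint nodes (A : Type) (t : bintree A) : seq A :=
  if t is Node l x r then nodes l ++ x :: nodes r else [::].

Section LeftRight.
Variables (n : nat) (T : triangulation n).
Local Notation vertex := (vertex n).

(* A triangle with distinguished edge {a, b}, a < b, and third vertex c is the
   triple (a, c, b).  The sub-polygon cut off by {a, b} lies between a and b, so
   a < c < b and {a,c}, {c,b}, {b,a} are placed counterclockwise. *)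
Definition fL (t : vertex * vertex * vertex) : edge n := (t.1.1, t.1.2).
Definition fR (t : vertex * vertex * vertex) : edge n := (t.1.2, t.2).

Definition apex (a b : vertex) : option vertex :=
  [pick c : vertex | [&& (a < c < b)%N, (a, c) \in val T & (c, b) \in val T]].

(* The recursive decomposition of the polygon with distinguished edge {a, b};
   [m] bounds the depth, and m >= b - a suffices. *)
Fixpoint dissect (m : nat) (a b : vertex) : bintree (vertex * vertex * vertex) :=
  if m is m'.+1 then
    if apex a b is Some c then Node (dissect m' a c) (a, c, b) (dissect m' c b)
    else Empty
  else Empty.

Definition triangle_tree := dissect n.+1 ord0 ord_max.

Definition tree_of : bintree unit := shape triangle_tree.

(* F^-1(L) and F^-1(R): the edges f_L(g), resp. f_R(g), over all triangles. *)
Definition left_edges : {set edge n} :=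
  [set f | f \in map fL (nodes triangle_tree)]%SET.
Definition right_edges : {set edge n} :=
  [set f | f \in map fR (nodes triangle_tree)]%SET.

(* k_L and k_R; meaningful for 1 <= k <= n, where the edge exists and is unique. *)
Definition kL (k : vertex) : vertex :=
  odflt ord0 [pick j : vertex | (j < k)%N && ((j, k) \in left_edges)].
Definition kR (k : vertex) : vertex :=
  odflt ord_max [pick j : vertex | (k < j)%N && ((k, j) \in right_edges)].

Definition varpi (i : vertex) : latN n :=
  cls (\row_(j < n.+1) ((j < i)%N%:R : int)).

Definition vvec (k : vertex) : latN n := varpi k - varpi (kR k).
Definition wvec (k : vertex) : latN n := varpi (kL k) - varpi k.

Definition Sigma (R : realType) : set (set (spaceN R n)) :=
  [set C | exists Q : set (latN n),
    [/\ Q `<=` [set x | exists k : vertex,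
                  (1 <= k <= n)%N /\ (x = vvec k \/ x = wvec k)],
        forall k : vertex, (1 <= k <= n)%N -> ~ (Q (vvec k) /\ Q (wvec k))
      & C = cone_of (latN_emb R @` Q)]].

End LeftRight.

Arguments Sigma {n} T R _.

(* The tree of a sequence rooted at its smallest entry; [m] bounds the depth,
   and m >= size s suffices. *)
Fixpoint min_tree (m : nat) (s : seq nat) : bintree nat :=
  if m is m'.+1 then
    if s is x :: s' then
      let a := foldr minn x s' in
      let p := index a s in
      Node (min_tree m' (take p s)) a (min_tree m' (drop p.+1 s))
    else Empty
  else Empty.

Definition psi (n : nat) (u : 'S_n) : bintree unit :=
  shape (min_tree n [seq val (u i) | i <- enum 'I_n]).

(* Positions and values of permutations are shifted from [1..m] to [0..m-1].  The
   product [(u * v)%g] applies [u] first. *)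

Definition w0 (n : nat) : 'S_n := perm (@rev_ord_inj n).

Definition simple_refl (n : nat) (i : 'I_n) : 'S_n.+1 :=
  tperm (widen_ord (leqnSn n) i) (lift ord0 i).

(* The composition of maps s_n s_(n-1) ... s_1. *)
Definition s_n1 (n : nat) : 'S_n.+1 := (\prod_(i < n) simple_refl i)%g.

Definition ut (n : nat) (u : 'S_n) : 'S_n.+1 := lift_perm ord_max ord_max u.

Definition perm_length (m : nat) (u : 'S_m) : nat :=
  #|[set p : 'I_m * 'I_m | (p.1 < p.2)%N && (u p.2 < u p.1)%N]%SET|.

Definition bruhat_step (m : nat) : rel 'S_m := fun v w =>
  [exists i, exists j, w == (tperm i j * v)%g] && (perm_length v < perm_length w)%N.

Definition bruhat_le (m : nat) : rel 'S_m := connect (@bruhat_step m).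

Definition perm_point (R : realType) (m : nat) (z : 'S_m) : 'rV[R]_m :=
  \row_i ((z i).+1)%:R.

Definition bruhat_polytope (R : realType) (m : nat) (v w : 'S_m) :
    set 'rV[R]_m :=
  conv_hull [set perm_point R z | z in [set z | bruhat_le v z && bruhat_le z w]].
Arguments bruhat_polytope R {m} v w.

(* Main.v *)
(* Work with the positions of u.  For x in [n] let l and r be the nearest positions to
   its left and right carrying a larger value (sentinels 0 and n+1).  For every z in
   the Bruhat interval the sum of z over (l, x] is at least that of u, and the sum over
   (x, r] is at least that of u over [x, r); both follow from comparing, threshold by
   threshold, the numbers of large values in initial segments.  The two inequalities are
   never tight together, and for every choice of one of them per x some z in the interval
   makes exactly the chosen ones tight: starting from u_t, go through the values from the
   largest to the smallest and swap each selected one with the next larger value of u on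
   its right.  So the polytope is a combinatorial cube, and its normal fan consists of the
   cones spanned by compatible subsets of the 2n facet normals, once these are known to
   cover the whole space.  The isomorphism x_i -> - x_(n+2-i) sends varpi_k to
   varpi_(n+1-k) and turns nearest larger values of u into nearest smaller values of
   w0 u w0, which are the base edges of the triangles of psi(w0 u w0); hence it matches
   the facet normals with the vectors v_k, w_k.  Covering is shown along the triangulation:
   modulo varpi_a and varpi_b, the base of a subpolygon, every combination of the
   varpi_k, a < k < b, is a combination of v_k's and w_k's that uses, with a nonnegative
   coefficient, only one of v_k, w_k for each k. *)

From HB Require Import structures.
Require Import Defs.
From mathcomp Require Import all_fingroup all_boot all_order all_algebra.
From mathcomp Require Import boolp classical_sets functions reals.
From mathcomp Require Import zify ring.

Set Implicit Arguments.
Unset Strict Implicit.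
Unset Printing Implicit Defensive.
Import Order.TTheory GRing.Theory Num.Theory.

(** * Bruhat order *)

(** Inversions of [v] inject into those of [w]: apply the transposition to both positions if this
    keeps their order, and leave the pair alone otherwise. The image misses the new inversion
    [(i, j)]. *)
Lemma perm_length_tperm_lt m (v : 'S_m) (i j : 'I_m) :
  (i < j)%N -> (v i < v j)%N ->
  (perm_length v < perm_length (tperm i j * v)%g)%N.
Proof.
move=> ij vij; set w := (tperm i j * v)%g.
pose t := tperm i j.
have wE x : w x = v (t x) by rewrite permM.
pose f (p : 'I_m * 'I_m) : 'I_m * 'I_m := if (t p.1 < t p.2)%N then (t p.1, t p.2) else p.
pose inv (z : 'S_m) := [set p : 'I_m * 'I_m | (p.1 < p.2)%N && (z p.2 < z p.1)%N]%SET.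
have ninj : {in inv v &, injective f}.
  move=> [a b] [c d]; rewrite !inE /f /= => /andP[ab _] /andP[cd _].
  case: ifPn => h1; case: ifPn => h2 [].
  - by move=> /perm_inj-> /perm_inj->.
  - by move=> e1 e2; move: h2; rewrite -e1 -e2 /t !tpermK ab.
  - by move=> e1 e2; move: h1; rewrite e1 e2 /t !tpermK cd.
  - by move=> -> ->.
have sub : (f @: inv v \subset inv w :\ (i, j))%SET.
  apply/fintype.subsetP => p /imsetP[[a b] + ->{p}]; rewrite !inE /= => /andP[ab vba].
  rewrite /f /=; case: ifPn => h.
    rewrite h !wE /t !tpermK vba /= andbT.
    apply/eqP => -[e1 e2]; move: ab.
    have -> : a = j by rewrite -[a](tpermK i j) e1 tpermL.
    have -> : b = i by rewrite -[b](tpermK i j) e2 tpermR.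
    lia.
  have nij : (a, b) != (i, j).
    by apply/eqP => -[e1 e2]; move: vba; rewrite e1 e2; lia.
  rewrite nij /= ab /= !wE.
  move: h nij; rewrite /t xpair_eqE.
  case: tpermP => [e1|e1|/eqP ai /eqP aj]; case: tpermP => [e|e|/eqP bi /eqP bj]; subst;
    rewrite ?eqxx /=; move=> *; try lia.
apply: leq_ltn_trans (_ : #|f @: inv v|%SET < _)%N.
  by rewrite card_in_imset.
apply: leq_ltn_trans (subset_leq_card sub) _.
rewrite [X in (_ < X)%N](cardsD1 (i, j)) inE /= ij !wE /t tpermL tpermR vij.
by rewrite add1n.
Qed.

Lemma bruhat_le_tperm m (v : 'S_m) (i j : 'I_m) :
  (i < j)%N -> (v i < v j)%N -> bruhat_le v (tperm i j * v)%g.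
Proof.
move=> ij vij; apply: connect1; rewrite /bruhat_step perm_length_tperm_lt //.
by rewrite andbT; apply/existsP; exists i; apply/existsP; exists j.
Qed.

Lemma bruhat_le_refl m (v : 'S_m) : bruhat_le v v.
Proof. exact: connect0. Qed.

Lemma bruhat_stepP m (v w : 'S_m) : bruhat_step v w ->
  exists i j : 'I_m, [/\ (i < j)%N, (v i < v j)%N & w = (tperm i j * v)%g].
Proof.
case/andP => /existsP[i /existsP[j /eqP wE]] len.
wlog ij : i j wE / (i < j)%N.
  move=> H; have [ij|ji|e] := ltngtP i j; first exact: (H i j).
    by apply: (H j i) => //; rewrite tpermC.
  move: len; rewrite wE (val_inj e) tperm1 mul1g ltnn //.
exists i, j; split => //.
have [//|vji|/val_inj/perm_inj e] := ltngtP (v i) (v j); last first.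
  by rewrite e ltnn in ij.
have : (perm_length w < perm_length (tperm i j * w)%g)%N.
  by apply: perm_length_tperm_lt => //; rewrite wE !permM tpermL tpermR.
by rewrite {2}wE mulgA tperm2 mul1g; lia.
Qed.

Definition seqfun n (z : 'S_n.+1) (i : nat) : nat := z (inord i).

(** In [k] and [t], this is the rank function of the tableau criterion for the Bruhat order. *)
Definition cnt (f : nat -> nat) (k t : nat) : nat :=
  (\sum_(i < k) (t <= f i)%N)%N.

Lemma seqfunE n (z : 'S_n.+1) (i : 'I_n.+1) : seqfun z i = z i.
Proof. by rewrite /seqfun inord_val. Qed.

Lemma seqfun_le n (z : 'S_n.+1) i : (seqfun z i <= n)%N.
Proof. by rewrite /seqfun -ltnS. Qed.

Lemma cnt_ord n (z : 'S_n.+1) k t : (k <= n.+1)%N ->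
  cnt (seqfun z) k t = (\sum_(i < n.+1) ((i < k) && (t <= z i)%N))%N.
Proof.
move=> kn; rewrite /cnt (big_ord_widen n.+1 (fun i => (t <= seqfun z i)%N : nat)) //.
rewrite big_mkcond; apply: eq_bigr => i _; rewrite seqfunE.
by case: ifP.
Qed.

(** The easy half of the tableau criterion: a step of the Bruhat order moves a larger value to an
    earlier position. *)
Lemma bruhat_le_cnt n (v w : 'S_n.+1) k t : bruhat_le v w -> (k <= n.+1)%N ->
  (cnt (seqfun v) k t <= cnt (seqfun w) k t)%N.
Proof.
move=> /connectP[p pth ->] kn {w}.
elim: p v pth => //= w p IH v /andP[/bruhat_stepP[i [j [ij vij wE]]] /IH].
apply: leq_trans; rewrite !cnt_ord // {IH p}.
rewrite [X in (_ <= X)%N](bigD1 i) // [X in (X <= _)%N](bigD1 i) //=.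
have ji : j != i by rewrite neq_ltn ij orbT.
rewrite [X in (_ <= _ + X)%N](bigD1 j) // [X in (_ + X <= _)%N](bigD1 j) //=.
rewrite !wE !permM tpermL tpermR.
under [X in (_ <= _ + (_ + X))%N]eq_bigr => l /andP[li lj] do
  rewrite permM tpermD 1?eq_sym //.
by case: (k <= i)%N; lia.
Qed.

(** * Inequalities on a Bruhat interval *)

Lemma s_n1_nat n : s_n1 n = (\prod_(0 <= i < n) tperm (inord i : 'I_n.+1) (inord i.+1))%g.
Proof.
rewrite big_mkord; apply: eq_bigr => i _; rewrite /simple_refl.
have le_in := ltn_ord i.
by congr tperm; apply: val_inj; rewrite /= inordK //=; lia.
Qed.

Lemma s_n1E n (i : 'I_n.+1) :
  s_n1 n i = inord (if i == 0%N :> nat then n else i.-1).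
Proof.
(* The left factor acts first, so the first [k] transpositions send 0 to [k], lower each of 1 to [k]
   by one and fix the rest. *)
suff H k : (k <= n)%N ->
    (\prod_(0 <= i < k) tperm (inord i : 'I_n.+1) (inord i.+1))%g i =
    inord (if i == 0%N :> nat then k else if (i <= k)%N then i.-1 else i).
  rewrite s_n1_nat H //; congr inord; case: eqP => // _.
  by rewrite -ltnS ltn_ord.
elim: k => [|k IH] kn.
  rewrite big_nil perm1; apply: val_inj; have li := ltn_ord i.
  by rewrite /= inordK; repeat case: ifP; lia.
rewrite big_nat_recr //= permM IH ?(ltnW kn) //.
set c := if _ then _ else _; have li := ltn_ord i.
have cn : (c <= n)%N by rewrite /c; repeat case: ifP; lia.
have inj a b : (a <= n)%N -> (b <= n)%N -> inord a = inord b :> 'I_n.+1 -> a = b.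
  by move=> ha hb /(congr1 val) /=; rewrite !inordK.
case: tpermP => [/inj e|/inj e|h1 h2]; congr inord.
- by move: (e cn (ltnW kn)); rewrite /c; repeat case: ifP; lia.
- by move: (e cn kn); rewrite /c; repeat case: ifP; lia.
have {}h1 : c <> k by move=> e; apply: h1; rewrite e.
have {}h2 : c <> k.+1 by move=> e; apply: h2; rewrite e.
by move: h1 h2; rewrite /c; repeat case: ifP; lia.
Qed.

Section Inequalities.
Variables (n : nat) (u : 'S_n).
Notation U := (seqfun (ut u)).
Notation W := (seqfun (s_n1 n * ut u)%g).

Lemma ut_max : ut u ord_max = ord_max.
Proof. by rewrite /ut lift_perm_id. Qed.

Lemma U_max : U n = n.
Proof.
by rewrite -[X in seqfun _ X]/(nat_of_ord (@ord_max n)) seqfunE ut_max.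
Qed.

Lemma W0 : W 0 = n.
Proof. by rewrite /seqfun permM s_n1E inordK //= -[RHS]U_max. Qed.

Lemma WS i : (i < n)%N -> W i.+1 = U i.
Proof. by move=> hi; rewrite /seqfun permM s_n1E inordK. Qed.

Lemma cntS f k t : cnt f k.+1 t = (cnt f k t + (t <= f k)%N)%N.
Proof. by rewrite /cnt big_ord_recr. Qed.

Lemma cnt_W k t : (k <= n)%N -> cnt W k.+1 t = ((t <= n)%N + cnt U k t)%N.
Proof.
move=> kn; rewrite /cnt big_ord_recl W0; congr (_ + _)%N.
by apply: eq_bigr => i _; rewrite WS // (leq_trans (ltn_ord i)).
Qed.

Lemma leq_cnt f j k t : (j <= k)%N -> (cnt f j t <= cnt f k t)%N.
Proof.
move=> /subnKC<-; elim: (k - j)%N => [|d IH]; first by rewrite addn0.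
by rewrite addnS cntS (leq_trans IH) ?leq_addr.
Qed.

Lemma cnt_eq f j k t : (j <= k)%N ->
  (forall i, (j <= i < k)%N -> (f i < t)%N) -> cnt f k t = cnt f j t.
Proof.
move=> /subnKC<-; elim: (k - j)%N => [|d IH] H; first by rewrite addn0.
rewrite addnS cntS IH; last by move=> i hi; apply: H; lia.
by rewrite leqNgt H ?addn0 //; lia.
Qed.

(* A number at most n is the number of thresholds in [1, n] that it reaches. *)
Lemma sum_cnt f a k : (a <= k)%N -> (forall i, (f i <= n)%N) ->
  (\sum_(a <= i < k) f i = \sum_(t < n) (cnt f k t.+1 - cnt f a t.+1))%N.
Proof.
move=> ak fn; move: (subnKC ak) => <-; elim: (k - a)%N => [|d IH].
  rewrite addn0 big_geq // big1 // => t _; lia.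
rewrite addnS big_nat_recr ?leq_addr //= IH.
have -> : f (a + d)%N = (\sum_(t < n) (t < f (a + d))%N)%N.
  rewrite -(big_mkord xpredT (fun t => (t < f (a + d)%N)%N : nat)).
  rewrite (big_cat_nat (n := f (a + d)%N)) //=.
  rewrite [X in (_ = _ + X)%N]big1_seq ?addn0.
    rewrite (eq_big_nat _ _ (F2 := fun=> 1%N)) ?sum_nat_const_nat; last by move=> i /andP[_ ->].
    lia.
  by move=> i /andP[_]; rewrite mem_index_iota => /andP[h _]; rewrite ltnNge h.
rewrite -big_split /=; apply: eq_bigr => t _; rewrite cntS.
by have := leq_cnt f t.+1 (leq_addr d a); lia.
Qed.

Variables (a x y : nat) (z : 'S_n.+1).
Hypotheses (ax : (a <= x)%N) (xy : (x < y)%N) (yn : (y <= n)%N).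
Hypothesis Ua : a = 0%N \/ (U x < U a.-1)%N.
Hypothesis Uy : (U x < U y)%N.
Hypothesis Ulow : forall i, (a <= i < y)%N -> (U i <= U x)%N.
Hypotheses (vz : bruhat_le (ut u) z) (zw : bruhat_le z (s_n1 n * ut u)%g).
Notation Z := (seqfun z).

Let lo k t : (k <= n.+1)%N -> (cnt U k t <= cnt Z k t)%N.
Proof. exact: bruhat_le_cnt. Qed.

(** [W] is [U] shifted right by one with the value [n] in front, which adds at most one large value
    to an initial segment. *)
Let hi k t : (k <= n)%N -> (cnt Z k.+1 t <= (cnt U k t).+1)%N.
Proof.
by move=> kn; have := bruhat_le_cnt t zw (k := k.+1) kn; rewrite cnt_W //; lia.
Qed.

(** The window is [[a, x]]. For [a = 0], [lo] suffices. Otherwise, if [U a.-1] reaches [t], combine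
    [lo] with the bound [hi] on the first [a] entries; if not, no value of [U] in the window reaches
    [t]. *)
Let cntA t : (cnt U x.+1 t + cnt Z a t <= cnt Z x.+1 t + cnt U a t)%N.
Proof.
have l := @lo x.+1 t ltac:(lia).
case: Ua => [->|Uax]; first by rewrite /cnt !big_ord0; move: l; rewrite /cnt; lia.
case a0: a Uax ax Ulow => [|a'] /= Uax ax' Ul.
  by rewrite /cnt !big_ord0; move: l; rewrite /cnt; lia.
have [tu|tu] := leqP t (U a').
  by have := @hi a' t ltac:(lia); rewrite (cntS U a') tu; lia.
rewrite (@cnt_eq U a'.+1 x.+1); [|lia|by move=> i hi'; have := Ul i; lia].
by have := @leq_cnt Z a'.+1 x.+1 t; lia.
Qed.

(** Here [Z] is counted on [(x, y]] and [U] on [[x, y)]. If [U y] reaches [t], the value at [y]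
    makes up for the extra one allowed by [hi]; otherwise no value of [U] on [[x, y)] reaches
    [t]. *)
Let cntB t : (cnt U y t + cnt Z x.+1 t <= cnt Z y.+1 t + cnt U x t)%N.
Proof.
have [tu|tu] := leqP t (U y).
  by have := @lo y.+1 t ltac:(lia); rewrite cntS tu; have := @hi x t ltac:(lia); lia.
rewrite (@cnt_eq U x y); [|lia|move=> i hi'; have := Ulow (i := i); lia].
by have := @leq_cnt Z x.+1 y.+1 t; lia.
Qed.

Lemma interval_sum_left : (\sum_(a <= i < x.+1) U i <= \sum_(a <= i < x.+1) Z i)%N.
Proof.
rewrite !sum_cnt //; try exact: seqfun_le; try lia.
apply: leq_sum => t _; have := cntA t.+1; lia.
Qed.

Lemma interval_sum_right : (\sum_(x <= i < y) U i <= \sum_(x.+1 <= i < y.+1) Z i)%N.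
Proof.
rewrite !sum_cnt //; try exact: seqfun_le; try lia.
by apply: leq_sum => t _; have := cntB t.+1; lia.
Qed.

(** At the threshold [(U x).+1], [U] has no large value on [[a, y)] but has one at [y]. This forces
    a large value of [Z] on [[a, y]], so [cntA] and [cntB] cannot both be equalities there. *)
Lemma interval_sum_not_both :
  (\sum_(a <= i < x.+1) Z i)%N = (\sum_(a <= i < x.+1) U i)%N ->
  (\sum_(x.+1 <= i < y.+1) Z i)%N = (\sum_(x <= i < y) U i)%N -> False.
Proof.
move=> e1 e2.
suff : (\sum_(a <= i < x.+1) U i + \sum_(x <= i < y) U i <
        \sum_(a <= i < x.+1) Z i + \sum_(x.+1 <= i < y.+1) Z i)%N by lia.
rewrite !sum_cnt //; try exact: seqfun_le; try lia.
rewrite -!big_split /=.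
have Uxn : (U x < n)%N by have := seqfun_le (ut u) y; lia.
rewrite (bigD1 (Ordinal Uxn)) // [X in (_ < X)%N](bigD1 (Ordinal Uxn)) //=.
rewrite -addSn; apply: leq_add; last first.
  by apply: leq_sum => t _; have := cntA t.+1; have := cntB t.+1; lia.
have e3 : cnt U x.+1 (U x).+1 = cnt U a (U x).+1.
  by apply: cnt_eq => [|i hi']; [lia | have := Ulow (i := i); lia].
have e4 : cnt U y (U x).+1 = cnt U x (U x).+1.
  by apply: cnt_eq => [|i hi']; [lia | have := Ulow (i := i); lia].
have e5 : cnt U x (U x).+1 = cnt U a (U x).+1.
  by apply: cnt_eq => // i hi'; have := Ulow (i := i); lia.
have l := @lo y.+1 (U x).+1 ltac:(lia); rewrite cntS Uy in l.
suff : (cnt Z a (U x).+1 <= cnt U a (U x).+1)%N.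
  have := cntA (U x).+1; have := cntB (U x).+1; lia.
case: Ua => [->|]; first by rewrite /cnt !big_ord0.
case a0: a ax => [|a'] /= ax' Uax; first by rewrite /cnt !big_ord0.
by have := @hi a' (U x).+1 ltac:(lia); rewrite (cntS U a') Uax; lia.
Qed.

End Inequalities.

(** * Vertices of the polytope *)

Section IntervalVertices.
Variables (n : nat) (u : 'S_n).
Notation V := (ut u).
Notation U := (seqfun (ut u)).
Implicit Types (e : pred 'I_n.+1) (i x y : 'I_n.+1) (z : 'S_n.+1).

(** The default [ord_max] carries the largest value of [V], so it qualifies whenever [V x < n]. *)
Definition next_larger x : 'I_n.+1 :=
  [arg min_(y < ord_max | (x < y)%N && (V x < V y)%N) y]%N.

Lemma next_largerP x : (V x < n)%N ->
  [/\ (x < next_larger x)%N, (V x < V (next_larger x))%N &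
      forall i, (x < i)%N -> (V x < V i)%N -> (next_larger x <= i)%N].
Proof.
move=> xn; rewrite /next_larger; case: arg_minnP => [|y /andP[h1 h2] h3].
  rewrite ut_max xn andbT ltn_neqAle -ltnS ltn_ord andbT.
  apply: contraTneq xn => e; have -> : x = ord_max by apply: val_inj.
  by rewrite ut_max ltnn.
by split => // i xi vi; apply: h3; rewrite xi vi.
Qed.

(* Position of the value [n - j], the [j]-th one to be processed, from the largest
   to the smallest. *)
Definition pos (j : nat) : 'I_n.+1 := (V^-1)%g (inord (n - j)).

Lemma V_pos j : V (pos j) = (n - j)%N :> nat.
Proof. by rewrite /pos permKV inordK //; lia. Qed.

(** The predicate [e] selects the positions whose right-hand inequality is to be tight. Multiplying
    on the left exchanges the entries in two positions; the partner is the next larger entry in [V],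
    not in the permutation reached so far. *)
Fixpoint vtx e (j : nat) : 'S_n.+1 :=
  if j is j'.+1 then
    if e (pos j) then (tperm (pos j) (next_larger (pos j)) * vtx e j')%g
    else vtx e j'
  else V.

Lemma vtxS e j : vtx e j.+1 =
  if e (pos j.+1) then (tperm (pos j.+1) (next_larger (pos j.+1)) * vtx e j)%g
  else vtx e j.
Proof. by []. Qed.

Lemma V_inj x y : V x = V y :> nat -> x = y.
Proof. by move=> /val_inj/perm_inj. Qed.

Lemma pos_V x : pos (n - V x) = x.
Proof. by apply: V_inj; rewrite V_pos; have := ltn_ord (V x); lia. Qed.

Lemma next_posP j : (0 < j <= n)%N ->
  let x := pos j in let y := next_larger x in
  [/\ V x = (n - j)%N :> nat, (x < y)%N, (V x < V y)%N &
      forall i, (x < i)%N -> (V x < V i)%N -> (y <= i)%N].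
Proof.
move=> jn; have h : (V (pos j) < n)%N by rewrite V_pos; lia.
by split; [exact: V_pos | case: (next_largerP h)..].
Qed.

(** Both positions of each swap made so far carry values of [V] that are at least [n - j], so
    smaller values have not moved. *)
Lemma vtx_small e j i : (j <= n)%N -> (V i < n - j)%N -> vtx e j i = V i.
Proof.
elim: j => //= j IH jn vi; case: ifP => _; last by apply: IH; lia.
have [e1 e2 e3 e4] := @next_posP j.+1 ltac:(lia).
rewrite permM tpermD ?IH //; try lia.
  by apply/eqP => e5; rewrite -e5 in vi; lia.
by apply/eqP => e5; rewrite -e5 in vi; lia.
Qed.

Lemma vtx_large e j i : (j <= n)%N -> (n - j <= V i)%N -> (n - j <= vtx e j i)%N.
Proof.
move=> jn vi; rewrite leqNgt; apply/negP => h.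
have k : V ((V^-1)%g (vtx e j i)) = vtx e j i by rewrite permKV.
have := @vtx_small e j ((V^-1)%g (vtx e j i)) jn; rewrite k => /(_ h)/perm_inj e5.
by rewrite e5 in k; rewrite k in vi; lia.
Qed.

Lemma vtx_next_larger e j : (j < n)%N ->
  (vtx e j (pos j.+1) < vtx e j (next_larger (pos j.+1)))%N.
Proof.
move=> jn; have [e1 e2 e3 e4] := @next_posP j.+1 ltac:(lia).
rewrite vtx_small ?e1; [|lia|lia].
by have := @vtx_large e j (next_larger (pos j.+1)) ltac:(lia) ltac:(lia); lia.
Qed.

Lemma vtx_ge e j : (j <= n)%N -> bruhat_le V (vtx e j).
Proof.
elim: j => [|j IH] jn /=; first exact: bruhat_le_refl.
case: ifP => _; last by apply: IH; lia.
have [_ e2 _ _] := @next_posP j.+1 ltac:(lia).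
apply: connect_trans (IH (ltnW jn)) _.
by apply: bruhat_le_tperm => //; exact: vtx_next_larger.
Qed.

Lemma vtx_eq e1 e2 j : (forall i, (n - j <= V i < n)%N -> e1 i = e2 i) ->
  vtx e1 j = vtx e2 j.
Proof.
elim: j => //= j IH H.
have [jn|nj] := ltnP j n.
  by rewrite H ?IH // => [i hi|]; [apply: H; lia | rewrite V_pos; lia].
rewrite (_ : pos j.+1 = pos n); last by apply: V_inj; rewrite !V_pos; lia.
rewrite IH => [|i hi]; last by apply: H; lia.
have [n0|n0] := posnP n; last by rewrite H // V_pos; lia.
have -> : next_larger (pos n) = pos n.
  by apply: val_inj => /=; have := ltn_ord (next_larger (pos n)); have := ltn_ord (pos n); lia.
by rewrite tperm1 mul1g; do 2 case: ifP.
Qed.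

(* The swap of the value [n - j] moves it past smaller values only, apart from the
   value it is exchanged with. *)
Lemma vtx_inv_ltn e j (c d : 'I_n.+1) : (j < n)%N -> (n - j.+1 < c)%N -> (n - j.+1 < d)%N ->
  ((vtx e j)^-1%g c < (vtx e j)^-1%g d)%N ->
  ((vtx e j.+1)^-1%g c < (vtx e j.+1)^-1%g d)%N.
Proof.
move=> jn jc jd; rewrite /=; case: ifP => // _.
have [] := @next_posP j.+1 ltac:(lia).
move: (pos j.+1) => x; set y := next_larger x => vx xy vxy ymin.
rewrite invMg tpermV !permM.
set p := (vtx e j)^-1%g c; set q := (vtx e j)^-1%g d => pq.
have zp : vtx e j p = c by rewrite permKV.
have zq : vtx e j q = d by rewrite permKV.
have zx : vtx e j x = (n - j.+1)%N :> nat by rewrite vtx_small ?vx //; lia.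
have npx : x != p by apply: contraTneq jc => xp; rewrite -zp -xp; lia.
have nqx : x != q by apply: contraTneq jd => xq; rewrite -zq -xq; lia.
have [yp|nyp] := eqVneq y p.
  rewrite -yp tpermR tpermD //; first by apply: ltn_trans xy _; rewrite yp.
  by rewrite yp; apply: contraTneq pq => ->; rewrite ltnn.
rewrite (tpermD npx nyp).
have [yq|nyq] := eqVneq y q; last by rewrite tpermD.
rewrite -yq tpermR ltnNge; apply/negP => xp.
have {xp} xp : (x < p)%N.
  by rewrite ltn_neqAle xp andbT; apply: contraNneq npx => /val_inj ->.
have vpx : (V p < V x)%N.
  rewrite ltnNge leq_eqVlt; apply/negP => /orP[/eqP/V_inj e5|h].
    by rewrite e5 eqxx in npx.
  by have := ymin p xp h; rewrite yq; lia.
have := @vtx_small e j p (ltnW jn) ltac:(lia); rewrite zp => e5.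
by rewrite -e5 in vpx; lia.
Qed.

(** The swap at [x] is an extra exchange of two values [c < d]. Later swaps multiply on the left and
    leave it as a factor [tperm c d] on the right; by [vtx_inv_ltn] they also keep [c] to the left
    of [d], so at the end it is still a step upwards. *)
Lemma vtx_toggle e1 e2 x : (V x < n)%N -> (forall i, i != x -> e1 i = e2 i) ->
  ~~ e1 x -> e2 x -> bruhat_le (vtx e1 n) (vtx e2 n).
Proof.
move=> xn e12 e1x e2x; pose j0 := (n - (V x).+1)%N.
have xj0 : pos j0.+1 = x by rewrite -[RHS]pos_V; congr pos; rewrite /j0; lia.
have eq0 : vtx e2 j0 = vtx e1 j0.
  apply: vtx_eq => i hi; rewrite e12 //; apply: contraTneq hi => ->; rewrite /j0; lia.
have lt0 := @vtx_next_larger e1 j0 ltac:(rewrite /j0; lia).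
have [_ xy _ _] := @next_posP j0.+1 ltac:(rewrite /j0; lia).
rewrite xj0 in lt0 xy.
set y := next_larger x in lt0 xy.
set c := vtx e1 j0 x in lt0; set d := vtx e1 j0 y in lt0.
have cE : c = V x by apply: vtx_small; rewrite /j0; lia.
have H k : (j0.+1 + k <= n)%N ->
    vtx e2 (j0.+1 + k) = (vtx e1 (j0.+1 + k) * tperm c d)%g /\
    ((vtx e1 (j0.+1 + k))^-1%g c < (vtx e1 (j0.+1 + k))^-1%g d)%N.
  elim: k => [|k IH] kn.
    rewrite addn0 /= xj0 e2x (negbTE e1x) eq0; split; last by rewrite !permK.
    by rewrite -(tpermJ x y (vtx e1 j0)) conjgE !mulgA mulgV mul1g.
  have {IH} [IH1 IH2] := IH ltac:(lia).
  rewrite addnS; split; last first.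
    by apply: vtx_inv_ltn => //; rewrite ?cE /j0; move: lt0; rewrite ?cE; lia.
  rewrite (vtxS e2) (vtxS e1) e12; first by rewrite IH1; case: ifP; rewrite ?mulgA.
  by apply/eqP => e5; have := V_pos (j0.+1 + k).+1; rewrite e5 /j0; lia.
have [E1 E2] := H (V x) ltac:(rewrite /j0; lia).
have nE : (j0.+1 + V x)%N = n by rewrite /j0; lia.
rewrite nE in E1 E2; rewrite E1; set z := vtx e1 n in E1 E2 *.
set p := (z^-1)%g c in E2; set q := (z^-1)%g d in E2.
have -> : (z * tperm c d = tperm p q * z)%g.
  rewrite -[c in LHS](permKV z) -[d in LHS](permKV z) -/p -/q.
  by rewrite -tpermJ conjgE !mulgA mulgV mul1g.
by apply: bruhat_le_tperm; rewrite // /p /q !permKV.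
Qed.

Lemma vtx_le_all e : bruhat_le (vtx e n) (vtx xpredT n).
Proof.
(* Positions are added to [e] one at a time by increasing value, each addition going up by
   [vtx_toggle]. *)
pose h k := fun i => e i || (V i < k)%N.
have H k : (k <= n)%N -> bruhat_le (vtx e n) (vtx (h k) n).
  elim: k => [|k IH] kn.
    rewrite (@vtx_eq e (h 0%N) n) ?bruhat_le_refl // => i _; rewrite /h ltn0 orbF //.
  apply: connect_trans (IH (ltnW kn)) _.
  pose x := pos (n - k); have vx : V x = k :> nat by rewrite V_pos; lia.
  have e12 i : i != x -> h k i = h k.+1 i.
    move=> ix; rewrite /h; congr (_ || _); rewrite [in RHS]ltnS [in RHS]leq_eqVlt.
    by case: eqP => //= e5; case/eqP: ix; apply: V_inj; rewrite vx.
  case ex : (e x).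
    rewrite (@vtx_eq (h k) (h k.+1)) ?bruhat_le_refl // => i _.
    by have [->|/e12//] := eqVneq i x; rewrite /h ex.
  apply: (@vtx_toggle _ _ x) => //; first by rewrite vx.
    by rewrite /h ex vx ltnn.
  by rewrite /h vx ltnS leqnn orbT.
have := H n (leqnn n); rewrite (@vtx_eq (h n) xpredT) // => i /andP[_ hi].
by rewrite /h hi orbT.
Qed.

End IntervalVertices.

(** * Window sums that are tight at the constructed vertices *)

Section TightSums.
Variables (n : nat) (u : 'S_n).
Notation V := (ut u).
Notation U := (seqfun (ut u)).
Notation W := (seqfun (s_n1 n * ut u)%g).
Implicit Types (e : pred 'I_n.+1) (i x y : 'I_n.+1) (z : 'S_n.+1).

Lemma sum_seqfun z c d : (d <= n.+1)%N ->
  (\sum_(c <= i < d) seqfun z i = \sum_(i < n.+1 | (c <= i < d)%N) z i)%N.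
Proof.
move=> dn; rewrite (big_nat_widen _ _ n.+1) // (@big_nat_widenl _ _ _ c 0) // big_mkord.
apply: eq_big => [i|i _]; last by rewrite seqfunE.
by rewrite /= andbC.
Qed.

Lemma sum_tperm z x y c d : (d <= n.+1)%N -> (c <= x < d)%N = (c <= y < d)%N ->
  (\sum_(c <= i < d) seqfun (tperm x y * z)%g i = \sum_(c <= i < d) seqfun z i)%N.
Proof.
move=> dn xy; rewrite !sum_seqfun // (reindex_inj (@perm_inj _ (tperm x y))) /=.
apply: eq_big => [i|i _]; last by rewrite permM tpermK.
by case: tpermP => [->|->|].
Qed.

(** After the stage of [x], only positions with smaller values of [V] are swapped with their next
    larger ones; the window sum survives if each such pair lies entirely inside or entirely outside
    the window. *)
Lemma sum_vtx_stable e x c d : (d <= n.+1)%N -> (V x <= n)%N ->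
  (forall i, (V i < V x)%N -> (c <= i < d)%N = (c <= next_larger u i < d)%N) ->
  (\sum_(c <= i < d) seqfun (vtx u e n) i =
   \sum_(c <= i < d) seqfun (vtx u e (n - V x)) i)%N.
Proof.
move=> dn vx H.
suff K k : (n - V x + k <= n)%N ->
    (\sum_(c <= i < d) seqfun (vtx u e (n - V x + k)) i =
     \sum_(c <= i < d) seqfun (vtx u e (n - V x)) i)%N.
  by rewrite -(K (V x)) ?subnK.
elim: k => [|k IH] kn; first by rewrite addn0.
rewrite addnS vtxS -IH; last by lia.
case: ifP => // _; rewrite sum_tperm // H // V_pos; lia.
Qed.

Section Node.
Variable x : 'I_n.+1.
Hypothesis xn : (V x < n)%N.
Let y := next_larger u x.

Let j0 := (n - (V x).+1)%N.

Let j0S : (n - V x = j0.+1)%N.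
Proof. by rewrite /j0; lia. Qed.

Let pos0 : pos u j0.+1 = x.
Proof. by rewrite -[RHS](pos_V u) -j0S. Qed.

(** If [x] is not selected, the window [[a, x]] is still untouched after its stage. Later swaps
    respect it: [x] stops those that start inside, and [a.-1] those that start to its left. *)
Lemma sum_vtx_left e a : (a <= x)%N -> a = 0%N \/ (V x < U a.-1)%N ->
  (forall i, (a <= i <= x)%N -> (V i <= V x)%N) -> ~~ e x ->
  (\sum_(a <= i < x.+1) seqfun (vtx u e n) i = \sum_(a <= i < x.+1) U i)%N.
Proof.
move=> ax Ha Hl ex; rewrite (@sum_vtx_stable e x) //; last 1 first.
- move=> i vi; have [h1 h2 h3] := next_largerP (ltn_trans vi xn).
  apply/idP/idP => /andP[ai ix].
    have {}ix : (i < x)%N.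
      by rewrite ltn_neqAle -ltnS ix andbT; apply: contraTneq vi => /val_inj ->; rewrite ltnn.
    by have := h3 x ix vi; lia.
  have {}ix : (i < x.+1)%N by lia.
  rewrite ix andbT leqNgt; apply/negP => ia.
  case: Ha => [a0|]; first by rewrite a0 in ia.
  have an : (a.-1 < n.+1)%N by have := ltn_ord x; lia.
  rewrite -[a.-1]/(nat_of_ord (Ordinal an)) seqfunE => va.
  have [ia1|ia1] := eqVneq i (Ordinal an); first by move: vi; rewrite ia1; lia.
  have {}ia1 : (i < Ordinal an)%N.
    by rewrite ltn_neqAle; apply/andP; split; [exact: ia1 | move=> /=; lia].
  by have /= := h3 (Ordinal an) ia1 ltac:(lia); lia.
- rewrite j0S vtxS pos0 (negbTE ex).
  apply: eq_big_nat => i hi; have iN : (i < n.+1)%N by have := ltn_ord x; lia.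
  rewrite -[i]/(nat_of_ord (Ordinal iN)) !seqfunE vtx_small //; first by rewrite /j0; lia.
  have := Hl (Ordinal iN) hi; rewrite /j0; lia.
- by have := ltn_ord (V x); lia.
Qed.

(** The swap at [x] puts [V x] at [y], so [(x, y]] then holds the values of [V] from [[x, y)]. Later
    swaps respect this window: [y] stops those that start inside, and [x] those that start to its
    left. *)
Lemma sum_vtx_right e : e x ->
  (\sum_(x.+1 <= i < y.+1) seqfun (vtx u e n) i = \sum_(x <= i < y) U i)%N.
Proof.
have [xy vxy ymin] := next_largerP xn; rewrite -/y in xy vxy ymin.
move=> ex; rewrite (@sum_vtx_stable e x) //; last 1 first.
- move=> i vi; have [h1 h2 h3] := next_largerP (ltn_trans vi xn).
  apply/idP/idP => /andP[ai ix].
    have {}ix : (i < y)%N.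
      by rewrite ltn_neqAle -ltnS ix andbT; apply: contraTneq vi => /val_inj ->; lia.
    by have := h3 y ix ltac:(lia); lia.
  have {}ix : (i < y.+1)%N by lia.
  rewrite ix andbT ltnNge leq_eqVlt; apply/negP => /orP[/eqP/val_inj e5|xi].
    by rewrite e5 ltnn in vi.
  by have := h3 x xi vi; lia.
- have low i : (x < i < y)%N -> (V i < V x)%N.
    move=> hi; rewrite ltnNge leq_eqVlt; apply/negP => /orP[/eqP/(V_inj)e5|h].
      by rewrite -e5 ltnn in hi.
    by have := ymin i ltac:(lia) h; lia.
  have yn := ltn_ord y; have xN := ltn_ord x.
  rewrite j0S vtxS pos0 ex -/y big_nat_recr //= [in RHS]big_ltn // addnC; congr (_ + _)%N.
    rewrite seqfunE permM tpermR seqfunE vtx_small //; rewrite /j0; lia.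
  apply: eq_big_nat => i hi; have iN : (i < n.+1)%N by lia.
  rewrite -[i]/(nat_of_ord (Ordinal iN)) !seqfunE.
  have lti := low (Ordinal iN) hi.
  rewrite permM tpermD; first by rewrite vtx_small //; rewrite /j0; lia.
    by apply/eqP => /(congr1 val) /=; lia.
  by apply/eqP => /(congr1 val) /=; lia.
- by have := ltn_ord (V x); lia.
Qed.

End Node.

Lemma sum_W x : (V x < n)%N -> let y := next_larger u x in
  (\sum_(x.+1 <= i < y.+1) W i = \sum_(x <= i < y) U i)%N.
Proof.
move=> xn y; rewrite big_add1 /=; apply: eq_big_nat => i hi.
by rewrite WS //; have := ltn_ord y; lia.
Qed.

(** Both permutations have equal sums over each window [(x, y]] with [y] the next larger position.
    Such windows chain up from any [k > 0] to the end, so all tail sums agree, and with them all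
    entries. *)
Lemma vtx_all : vtx u xpredT n = (s_n1 n * ut u)%g.
Proof.
set z := vtx _ _ _; set w := (_ * _)%g.
have S k : (0 < k <= n.+1)%N ->
    (\sum_(k <= i < n.+1) seqfun z i = \sum_(k <= i < n.+1) seqfun w i)%N.
  have [m] := ubnP (n.+1 - k); elim: m k => // m IH k km k0.
  have [->|kn] := eqVneq k n.+1; first by rewrite !big_geq.
  have kN : (k.-1 < n.+1)%N by lia.
  pose x := Ordinal kN; pose y := next_larger u x.
  have xn : (V x < n)%N.
    rewrite ltn_neqAle -ltnS ltn_ord andbT; apply/eqP => e5.
    have /perm_inj/(congr1 val)/= : V x = V ord_max by apply: val_inj; rewrite ut_max.
    lia.
  have [xy _ _] := next_largerP xn; rewrite -/y /= in xy.
  have yn := ltn_ord y.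
  have zy := sum_vtx_right xn (e := xpredT) isT; rewrite -/y -/z in zy.
  have wy := sum_W xn; rewrite /= -/y -/w in wy.
  rewrite /= (_ : k.-1.+1 = k) in zy wy; last by lia.
  rewrite (@big_cat_nat _ _ _ y.+1) /=; [|lia|lia].
  rewrite zy -wy [RHS](@big_cat_nat _ _ _ y.+1) /=; [|lia|lia].
  by rewrite IH //; lia.
have T (z1 : 'S_n.+1) : (\sum_(0 <= i < n.+1) seqfun z1 i = \sum_(i < n.+1) i)%N.
  rewrite sum_seqfun // [RHS](reindex_inj (@perm_inj _ z1)) /=.
  by apply: eq_bigl => i; rewrite ltn_ord.
apply/perm.permP => i; apply: val_inj; rewrite /= -!seqfunE.
have iN := ltn_ord i.
have h k : (k <= n.+1)%N ->
    (\sum_(k <= i < n.+1) seqfun z i = \sum_(k <= i < n.+1) seqfun w i)%N.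
  by case: k => [|k] kn; [rewrite !T | rewrite S].
have := h i (ltnW iN); rewrite big_ltn // [RHS]big_ltn // h //.
by move=> /addIn.
Qed.

Lemma vtx_le e : bruhat_le (vtx u e n) (s_n1 n * ut u)%g.
Proof. by rewrite -vtx_all vtx_le_all. Qed.

End TightSums.

(** * Normal fans of combinatorial cubes *)

Section Dot.
Local Open Scope ring_scope.
Variables (R : realType) (m : nat).
Implicit Types a b x y : 'rV[R]_m.

Lemma dotBr a x y : dot a (x - y) = dot a x - dot a y.
Proof. by rewrite /dot -sumrB; apply: eq_bigr => i _; rewrite !mxE mulrBr. Qed.

Lemma dot_sumr a l (c : 'I_l -> R) (q : 'I_l -> 'rV[R]_m) :
  dot a (\sum_i c i *: q i) = \sum_i c i * dot a (q i).
Proof.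
rewrite /dot; under [RHS]eq_bigr do rewrite mulr_sumr.
rewrite exchange_big /=; apply: eq_bigr => j _.
rewrite summxE mulr_sumr; apply: eq_bigr => i _.
by rewrite mxE mulrCA.
Qed.

Lemma dot_suml l (c : 'I_l -> R) (q : 'I_l -> 'rV[R]_m) x :
  dot (\sum_i c i *: q i) x = \sum_i c i * dot (q i) x.
Proof.
have dC a b : dot a b = dot b a by apply: eq_bigr => i _; rewrite mulrC.
by rewrite dC dot_sumr; apply: eq_bigr => i _; rewrite dC.
Qed.

Lemma dot_const1 x : dot (const_mx 1) x = \sum_i x 0 i.
Proof. by apply: eq_bigr => i _; rewrite mxE mul1r. Qed.

End Dot.

Section Cones.
Local Open Scope ring_scope.
Local Open Scope classical_set_scope.
Variable R : realType.

Lemma scale_cls (K : nzRingType) n (a : K) (x : 'rV[K]_n.+1) : a *: cls x = cls (a *: x).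
Proof. exact: cscale_cls. Qed.

Lemma sum_scale_cls n l (c : 'I_l -> R) (q : 'I_l -> 'rV[R]_n.+1) :
  \sum_i c i *: cls (q i) = cls (\sum_i c i *: q i).
Proof. by rewrite raddf_sum; apply: eq_bigr => i _; rewrite scale_cls. Qed.

Lemma cone_of_sum (V : lmodType R) (S : set V) (I : finType) (P : pred I)
    (c : I -> R) (q : I -> V) :
  (forall i, P i -> S (q i)) -> (forall i, P i -> 0 <= c i) ->
  cone_of S (\sum_(i | P i) c i *: q i).
Proof.
move=> Sq c0; exists #|P|, (fun j => q (enum_val j)), (fun j => c (enum_val j)).
split=> [j|j|]; [apply: Sq; exact: (enum_valP j) | apply: c0; exact: (enum_valP j) |].
by rewrite -(big_enum_val (fun i => c i *: q i)); apply: eq_bigl.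
Qed.

Lemma conv_hull_sub (V : lmodType R) (S : set V) : S `<=` conv_hull S.
Proof.
move=> x Sx; exists 1%N, (fun=> x), (fun=> 1); split => //.
  by rewrite big_ord1.
by rewrite big_ord1 scale1r.
Qed.

Lemma conv_hull_dot_ge m (S : set 'rV[R]_m) a b :
  (forall z, S z -> b <= dot a z) -> forall y, conv_hull S y -> b <= dot a y.
Proof.
move=> H y [l [q [c [Sq c0 c1 ->]]]]; rewrite dot_sumr.
rewrite -[b]mul1r -c1 mulr_suml; apply: ler_sum => i _.
by apply: ler_wpM2l => //; exact: H.
Qed.

Lemma conv_hull_dot_eq m (S : set 'rV[R]_m) a b :
  (forall z, S z -> dot a z = b) -> forall y, conv_hull S y -> dot a y = b.
Proof.
move=> H y [l [q [c [Sq c0 c1 ->]]]]; rewrite dot_sumr.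
by rewrite -[b]mul1r -c1 mulr_suml; apply: eq_bigr => i _; rewrite H.
Qed.

End Cones.

Section NormalFan.
Local Open Scope ring_scope.
Local Open Scope classical_set_scope.
Variables (R : realType) (n m : nat) (Z : set 'rV[R]_n.+1) (s : R).
Variables (ray : 'I_m -> bool -> 'rV[R]_n.+1) (lo : 'I_m -> bool -> R).
Hypothesis Zs : forall z, Z z -> \sum_i z 0 i = s.
Hypothesis Zlo : forall z k d, Z z -> lo k d <= dot (ray k d) z.
Hypothesis Zvertex : forall e : 'I_m -> bool, exists2 z, Z z &
  forall k d, dot (ray k d) z = lo k d <-> d = e k.
Hypothesis complete : forall x : spaceN R n, exists (e : 'I_m -> bool) (c : 'I_m -> R),
  (forall k, 0 <= c k) /\ x = \sum_k c k *: cls (ray k (e k)).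

Notation P := (conv_hull Z).

Let Plo z k d : P z -> lo k d <= dot (ray k d) z.
Proof. by apply: conv_hull_dot_ge => ?; exact: Zlo. Qed.

Let Psum y p : P y -> P p -> \sum_i (y - p) 0 i = 0.
Proof.
have H z : P z -> \sum_i z 0 i = s.
  move=> Pz; rewrite -dot_const1; apply: conv_hull_dot_eq Pz => w Zw.
  by rewrite dot_const1 Zs.
move=> Py Pp; under eq_bigr do rewrite !mxE.
by rewrite sumrB !H // subrr.
Qed.

Let pairing_sum l (c : 'I_l -> R) (q : 'I_l -> 'rV[R]_n.+1) y p : P y -> P p ->
  pairing (\sum_i c i *: cls (q i)) (y - p) = \sum_i c i * (dot (q i) y - dot (q i) p).
Proof.
move=> Py Pp; rewrite sum_scale_cls pairing_cls ?Psum // dot_suml.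
by apply: eq_bigr => i _; rewrite dotBr.
Qed.

(** The functional combines one ray of each opposite pair. For nonnegative [c], only the support of
    [c] matters, by [faceP]. *)
Let face (e : 'I_m -> bool) (c : 'I_m -> R) : set 'rV[R]_n.+1 :=
  [set y | P y /\ dot (\sum_k c k *: ray k (e k)) y = \sum_k c k * lo k (e k)].

Let faceP e c y : (forall k, 0 <= c k) -> P y ->
  face e c y <-> forall k, 0 < c k -> dot (ray k (e k)) y = lo k (e k).
Proof.
move=> c0 Py; split=> [[_]|H].
  move=> /eqP; rewrite dot_suml -subr_eq0 -sumrB psumr_eq0 => [/allP H k ck|k _].
    have := H k (mem_index_enum k); rewrite -mulrBr mulf_eq0 gt_eqF //= subr_eq0.
    by move/eqP.
  by rewrite -mulrBr mulr_ge0 // subr_ge0 Plo.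
split=> //; rewrite dot_suml; apply: eq_bigr => k _.
have := c0 k; rewrite le_eqVlt => /orP[/eqP<-|/H ->//].
by rewrite !mul0r.
Qed.

Let face_lower_bound e c y : (forall k, 0 <= c k) -> P y ->
  \sum_k c k * lo k (e k) <= dot (\sum_k c k *: ray k (e k)) y.
Proof.
move=> c0 Py; rewrite dot_suml; apply: ler_sum => k _.
by rewrite ler_wpM2l // Plo.
Qed.

(** For the inclusion into the cone, expand [x] by [complete]. A ray that has positive coefficient
    but is not among the generators would fail to be tight at some vertex of the face, although [x]
    takes its minimum over [P] there. *)
Let normal_cone_face e c : (forall k, 0 <= c k) ->
  normal_cone P (face e c) = cone_of [set cls (ray k (e k)) | k in [set k | 0 < c k]].
Proof.
move=> c0; apply/seteqP; split=> x /= Hx; last first.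
  case: Hx => l [q [b [Sq b0 ->]]] y p Py Ep.
  have Pp : P p by case: Ep.
  have /choice[f Hf] i : exists k, 0 < c k /\ cls (ray k (e k)) = q i.
    by have [k ck <-] := Sq i; exists k.
  have -> : \sum_i b i *: q i = \sum_i b i *: cls (ray (f i) (e (f i))).
    by apply: eq_bigr => i _; rewrite (Hf i).2.
  rewrite pairing_sum //; apply: sumr_ge0 => i _; apply: mulr_ge0 => //.
  by rewrite subr_ge0 (faceP e c0 Pp).1 ?Plo //; case: (Hf i).
have [d [b [b0 xE]]] := complete x.
have H k : 0 < b k -> 0 < c k /\ d k = e k.
  (* At [k], [e'] differs from [e] only if [d k = e k]; then [c k] is not positive, so the vertex of
     [e'] still lies in the face. *)
  move=> bk; pose e' j := if j == k then ~~ d k else e j.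
  apply: contrapT => Hk.
  have [z' Zz' z'P] := Zvertex e'; have [z Zz zP] := Zvertex d.
  have Pz' := conv_hull_sub Zz'; have Pz := conv_hull_sub Zz.
  have : face e c z'.
    apply/faceP => // j cj; apply/z'P; rewrite /e'; case: eqP => // jk.
    by rewrite jk in cj *; case: (d k) (e k) Hk => -[] //= Hk; case: Hk.
  move=> /(Hx z z' Pz); rewrite xE pairing_sum // => le0.
  have /eqP : \sum_k0 b k0 * (dot (ray k0 (d k0)) z' - dot (ray k0 (d k0)) z) = 0.
    apply/le_anti/andP; split.
      rewrite -oppr_ge0 -sumrN (eq_bigr _ (fun i _ => esym (mulrN _ _))).
      by under eq_bigr do rewrite opprB.
    apply: sumr_ge0 => j _; apply: mulr_ge0 => //.
    by rewrite subr_ge0 ((zP j (d j)).2 erefl) Plo.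
  rewrite psumr_eq0 => [/allP/(_ k (mem_index_enum k))|j _]; last first.
    by apply: mulr_ge0 => //; rewrite subr_ge0 ((zP j (d j)).2 erefl) Plo.
  rewrite mulf_eq0 gt_eqF //= subr_eq0 ((zP k (d k)).2 erefl) => /eqP/z'P.
  by rewrite /e' eqxx; case: (d k).
rewrite xE (bigID (fun k => 0 < b k)) /= [X in _ + X]big1 ?addr0 => [|k bk].
  apply: cone_of_sum => // k bk; have [ck ->] := H k bk.
  by exists k.
have -> : b k = 0 by apply/eqP; rewrite eq_le b0 andbT leNgt.
by rewrite scale0r.
Qed.

(* [ray k true] and [ray k false] are the inward normals of a pair of opposite facets
   of a combinatorial cube. *)
Lemma normal_fan_cube : normal_fan P =
  [set C | exists I : set ('I_m * bool), (forall k, ~ (I (k, true) /\ I (k, false))) /\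
     C = cone_of [set cls (ray p.1 p.2) | p in I]].
Proof.
have face_n0 e c : (forall k, 0 <= c k) -> face e c !=set0.
  move=> c0; have [z Zz zP] := Zvertex e; exists z.
  by apply/faceP => //; [exact: conv_hull_sub | move=> k _; apply/zP].
apply/seteqP; split=> C /=.
  move=> [E [[a [b [Pb EE]]] E0 ->]].
  have [e [c [c0 aE]]] := complete (cls a).
  (* Modulo [(1, ..., 1)], [a] is a nonnegative combination of rays. Coordinate sums are constant on
     [P], so the two functionals differ there by a constant and cut out the same face. *)
  have dotE y p : P y -> P p -> dot a y - dot a p =
      dot (\sum_k c k *: ray k (e k)) y - dot (\sum_k c k *: ray k (e k)) p.
    move=> Py Pp; rewrite -!dotBr -!(pairing_cls _ (Psum Py Pp)).
    by rewrite aE sum_scale_cls.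
  have {EE} -> : E = face e c.
    have [z [Pz zE]] := face_n0 e c c0.
    have [p] := E0; rewrite EE => -[Pp pE].
    have pz : dot a z = b.
      apply/le_anti; rewrite Pb // andbT -pE -subr_le0 dotE // zE.
      by rewrite subr_le0 face_lower_bound.
    apply/seteqP; split=> y [Py yE]; split => //.
      by apply/eqP; rewrite -zE -subr_eq0 -dotE // yE pz subrr.
    by apply/eqP; rewrite -pz -subr_eq0 dotE // yE zE subrr.
  exists [set p | 0 < c p.1 /\ p.2 = e p.1]; split=> [k [[_ /= <-] [_ /=]]//|].
  rewrite normal_cone_face //; congr cone_of; apply/seteqP; split=> x /=.
    by move=> [k ck <-]; exists (k, e k).
  by move=> [[k d] /= [ck ->] <-]; exists k.
move=> [I [HI ->]].
(* [I] meets each pair at most once: [e] picks its member, and [c] is 0 where there is none. *)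
pose e k := `[< I (k, true) >]; pose c k : R := if `[< I (k, e k) >] then 1 else 0.
have c0 k : 0 <= c k by rewrite /c; case: ifP.
exists (face e c); split => //; last first.
- rewrite normal_cone_face //; congr cone_of; apply/seteqP; split=> x /=.
    move=> [[k d] Ikd <-] /=; exists k; last first.
      congr (cls (ray k _)); rewrite /e; case: d Ikd => Ikd; first exact/asboolP.
      by apply/asboolP => Ik; apply: (HI k).
    rewrite /c; case: asboolP => // -[]; rewrite /e.
    by case: d Ikd => Ikd; case: asboolP.
  by move=> [k]; rewrite /c; case: asboolP => [Ik _ <-|_]; [exists (k, e k) | rewrite ltxx].
- exact: face_n0.
exists (\sum_k c k *: ray k (e k)), (\sum_k c k * lo k (e k)); split => //.
by move=> y Py; exact: face_lower_bound.
Qed.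

(** Going from [z], tight for the first ray and not for the second, to [z'], tight for the second,
    the first functional does not decrease while the second strictly decreases. *)
Lemma ray_inj (p q : 'I_m * bool) :
  cls (ray p.1 p.2) = cls (ray q.1 q.2) -> p = q.
Proof.
case: p q => [j d] [i d'] /= E; apply/eqP/negPn/negP => ne.
pose e k := if k == i then ~~ d' else d.
have ej : e j = d.
  rewrite /e; case: eqP => // ji; move: ne; rewrite ji xpair_eqE eqxx /=.
  by case: (d) (d') => -[].
have [z Zz zP] := Zvertex e; have [z' Zz' z'P] := Zvertex (fun=> d').
have y0 : \sum_k (z' - z) 0 k = 0 by apply: Psum; exact: conv_hull_sub.
have : dot (ray j d) (z' - z) = dot (ray i d') (z' - z).
  by rewrite -!(pairing_cls _ y0) E.
rewrite !dotBr ((zP j d).2 (esym ej)) ((z'P i d').2 erefl) => D.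
have /zP : dot (ray i d') z = lo i d'.
  apply/le_anti; rewrite Zlo // andbT -subr_ge0 -D subr_ge0.
  exact: Zlo.
by rewrite /e eqxx; case: (d').
Qed.

End NormalFan.

(** * Binary trees and triangulations *)

Section TreeSize.

Lemma size_nodes_shape A (t : bintree A) : size (nodes (Defs.shape t)) = size (nodes t).
Proof. by elim: t => //= l IHl x r IHr; rewrite !size_cat /= IHl IHr. Qed.

Lemma foldr_minnP x (s : seq nat) :
  (foldr minn x s \in x :: s) /\ forall y, y \in x :: s -> (foldr minn x s <= y)%N.
Proof.
elim: s => [|z s [IH1 IH2]] /=.
  by rewrite mem_seq1; split => // y; rewrite mem_seq1 => /eqP->.
split=> [|y].
  move: IH1; rewrite !inE /minn; case: ifP => _; first by rewrite eqxx orbT.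
  by case/orP => [->//|->]; rewrite !orbT.
rewrite inE orbCA => /orP[/eqP->|]; first exact: geq_minl.
by move=> hy; rewrite geq_min (IH2 y) ?orbT.
Qed.

Lemma min_tree_nil m : min_tree m [::] = Defs.Empty.
Proof. by case: m. Qed.

Lemma min_tree_argmin m (s : seq nat) p : (p < size s)%N ->
  (forall i, (i < size s)%N -> i != p -> (nth 0 s p < nth 0 s i)%N) ->
  min_tree m.+1 s =
    Node (min_tree m (take p s)) (nth 0 s p) (min_tree m (drop p.+1 s)).
Proof.
case: s => // x s ps H; have [] := foldr_minnP x s.
move=> /= h1 h2; have ip : index (foldr minn x s) (x :: s) = p.
  apply/eqP/negPn/negP => ne.
  have := H (index (foldr minn x s) (x :: s)) _ ne; rewrite index_mem h1 => /(_ isT).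
  by rewrite nth_index // ltnNge h2 // mem_nth.
by rewrite -[in RHS]ip nth_index //= -/(index _ (x :: s)).
Qed.

Lemma size_min_tree m (s : seq nat) : (size s <= m)%N -> size (nodes (min_tree m s)) = size s.
Proof.
elim: m s => [|m IH] [|x s] //= sm.
have [h1 _] := foldr_minnP x s.
have := index_mem (foldr minn x s) (x :: s); rewrite h1 /=.
set p := (if _ then _ else _) => hp.
by rewrite size_cat /= !IH ?size_take ?size_drop /=; case: ltnP; lia.
Qed.

End TreeSize.

(** * Dissection trees *)

Section Dissection.
Variable n : nat.
Implicit Types (T : triangulation n) (a b c : vertex n).

Lemma apexP T a b c : apex T a b = Some c ->
  [/\ (a < c < b)%N, (a, c) \in val T & (c, b) \in val T].
Proof. by rewrite /apex; case: pickP => // d /and3P[h1 h2 h3] [<-]. Qed.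

Lemma size_dissect T m a b : (size (nodes (dissect T m a b)) <= b - a.+1)%N.
Proof.
elim: m a b => //= m IH a b; case E : apex => [c|] //=.
have [h _ _] := apexP E.
by rewrite size_cat /=; have := IH a c; have := IH c b; lia.
Qed.

(* A dissection into as many triangles as possible is determined by the shape of
   its tree: the size of the left subtree gives the apex. *)
Lemma dissect_shape_inj T1 T2 m a b :
  size (nodes (dissect T1 m a b)) = (b - a.+1)%N ->
  Defs.shape (dissect T1 m a b) = Defs.shape (dissect T2 m a b) ->
  dissect T1 m a b = dissect T2 m a b.
Proof.
elim: m a b => //= m IH a b.
case E1 : apex => [c|]; case E2 : apex => [d|] //= sz [sl sr].
have [h1 _ _] := apexP E1; have [h2 _ _] := apexP E2.
rewrite size_cat /= in sz.
have := size_dissect T1 m a c; have := size_dissect T1 m c b => s1 s2.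
have := congr1 (fun t => size (nodes t)) sl; have := congr1 (fun t => size (nodes t)) sr.
rewrite !size_nodes_shape => er el.
have := size_dissect T2 m a d; have := size_dissect T2 m d b => s3 s4.
have cd : c = d by apply: val_inj => /=; lia.
subst d; have le_l := IH a c ltac:(lia) sl; have le_r := IH c b ltac:(lia) sr.
by rewrite le_l le_r.
Qed.

Lemma nodes_dissect_base T m a b t : (a, b) \in val T ->
  t \in nodes (dissect T m a b) -> (t.1.1, t.2) \in val T.
Proof.
elim: m a b => //= m IH a b abT; case E : apex => [c|] //=.
have [_ h1 h2] := apexP E.
by rewrite mem_cat inE => /or3P[|/eqP->|]; [apply: IH | | apply: IH].
Qed.

Lemma polygon_side_triangulation T f : f \in polygon_sides n -> f \in val T.
Proof.
move=> fs; have := valP T; rewrite /is_triangulation => /and4P[_ /fintype.subsetP H _ _].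
exact: H.
Qed.

(** All triangulations have the same sides and [n.-1] diagonals, so inclusion forces equality. *)
Lemma triangulation_sub_eq T1 T2 : val T1 \subset val T2 -> T1 = T2.
Proof.
move=> sub; apply: val_inj; apply/eqP; rewrite eqEcard sub /=.
rewrite -(cardsID (polygon_sides n) (val T1)) -(cardsID (polygon_sides n) (val T2)).
have sd T : (val T :&: polygon_sides n = polygon_sides n)%SET.
  apply/finset.setIidPr/fintype.subsetP => f; exact: polygon_side_triangulation.
have cd T : #|(val T :\: polygon_sides n)%SET| = n.-1.
  by have := valP T; rewrite /is_triangulation => /and4P[_ _ _ /eqP].
by rewrite !sd !cd.
Qed.

End Dissection.

Section Indexing.
Variable n : nat.

Definition nd (i : 'I_n) : vertex n := inord i.+1.

Lemma val_nd i : nd i = i.+1 :> nat.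
Proof. by rewrite /nd inordK //; have := ltn_ord i; lia. Qed.

Lemma nd_bounds i : (0 < nd i <= n)%N.
Proof. by rewrite val_nd /= ltn_ord. Qed.

Lemma nd_onto (k : vertex n) : (0 < k <= n)%N -> exists i, nd i = k.
Proof.
move=> hk; have h : (k.-1 < n)%N by lia.
by exists (Ordinal h); apply: val_inj; rewrite /= val_nd /=; lia.
Qed.

End Indexing.

(** * The triangulation of a sequence of distinct numbers *)

Section SequenceTriangulation.
Variables (n : nat) (s : seq nat).
Hypotheses (n0 : (0 < n)%N) (ss : size s = n) (us : uniq s).
Implicit Types (a b c k l : vertex n) (f : edge n).

(** Vertices 0 and [n.+1] have height 0, the latter as the default value of [nth]; the successor
    makes all inner heights positive. *)
Definition ht (i : nat) : nat := nth 0 (0 :: [seq x.+1 | x <- s]) i.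

Lemma htS i : (i < n)%N -> ht i.+1 = (nth 0 s i).+1.
Proof. by move=> hi; rewrite /ht /= (nth_map 0) ?ss. Qed.

Lemma ht_max : ht n.+1 = 0.
Proof. by rewrite /ht /= nth_default // size_map ss. Qed.

Lemma ht_gt0 i : (0 < i <= n)%N -> (0 < ht i)%N.
Proof. by case: i => // i hi; rewrite htS. Qed.

Lemma ht_inj i j : (0 < i <= n)%N -> (0 < j <= n)%N -> ht i = ht j -> i = j.
Proof.
case: i j => // i [] // j hi hj; rewrite !htS // => -[/eqP].
by rewrite nth_uniq ?ss // => /eqP ->.
Qed.

Definition seq_edges : {set edge n} :=
  [set f : edge n | (f.1 < f.2)%N &&
    [forall l : vertex n, (f.1 < l < f.2)%N ==>
       ((ht f.1 < ht l)%N && (ht f.2 < ht l)%N)]]%SET.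

Lemma seq_edgesP a b : reflect
  ((a < b)%N /\ forall l, (a < l < b)%N -> (ht a < ht l)%N /\ (ht b < ht l)%N)
  ((a, b) \in seq_edges).
Proof.
rewrite inE /=; apply: (iffP andP) => -[ab H]; split => //.
  by move=> l hl; have /implyP/(_ hl)/andP := forallP H l.
by apply/forallP => l; apply/implyP => /H[-> ->].
Qed.

(** The vertices [lf k], [k] and [rt k] will form the triangle with apex [k]. The defaults are the
    end vertices, of height 0. *)
Definition lf k : vertex n := [arg max_(x > ord0 | (x < k)%N && (ht x < ht k)%N) x]%N.
Definition rt k : vertex n := [arg min_(x < ord_max | (k < x)%N && (ht x < ht k)%N) x]%N.

Lemma lfP k : (0 < k <= n)%N -> [/\ (lf k < k)%N, (ht (lf k) < ht k)%N &
  forall l, (lf k < l < k)%N -> (ht k < ht l)%N].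
Proof.
move=> hk; rewrite /lf; case: arg_maxnP => [|x /andP[h1 h2] h3].
  by rewrite /= (ht_gt0 hk); case/andP: hk => ->.
split=> // l hl; rewrite ltnNge leq_eqVlt; apply/negP => /orP[/eqP/ht_inj e|h].
  by have := e ltac:(lia) hk; lia.
by have := h3 l; rewrite h andbT => /(_ ltac:(lia)); lia.
Qed.

Lemma rtP k : (0 < k <= n)%N -> [/\ (k < rt k)%N, (ht (rt k) < ht k)%N &
  forall l, (k < l < rt k)%N -> (ht k < ht l)%N].
Proof.
move=> hk; rewrite /rt; case: arg_minnP => [|x /andP[h1 h2] h3].
  by rewrite /= ht_max (ht_gt0 hk) andbT; lia.
have xn := ltn_ord x.
split=> // l hl; rewrite ltnNge leq_eqVlt; apply/negP => /orP[/eqP/ht_inj e|h].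
  by have := e ltac:(lia) hk; lia.
by have := h3 l; rewrite h andbT => /(_ ltac:(lia)); lia.
Qed.

Lemma node_min k l : (0 < k <= n)%N -> (lf k < l < rt k)%N -> l != k -> (ht k < ht l)%N.
Proof.
move=> hk hl /eqP lk; have [_ _ L] := lfP hk; have [_ _ Rr] := rtP hk.
have [lt|gt|e] := ltngtP l k; [apply: L|apply: Rr|by case: lk; apply: val_inj]; lia.
Qed.

Lemma node_base k : (0 < k <= n)%N -> (lf k, rt k) \in seq_edges.
Proof.
move=> hk; have [l1 l2 l3] := lfP hk; have [r1 r2 r3] := rtP hk.
apply/seq_edgesP; split => [|l hl]; first by lia.
have [->//|lk] := eqVneq l k.
by have := node_min hk hl lk; lia.
Qed.

Lemma node_left k : (0 < k <= n)%N -> (lf k, k) \in seq_edges.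
Proof.
move=> hk; have [l1 l2 l3] := lfP hk.
by apply/seq_edgesP; split => // l hl; have := l3 l hl; lia.
Qed.

Lemma node_right k : (0 < k <= n)%N -> (k, rt k) \in seq_edges.
Proof.
move=> hk; have [l1 l2 l3] := rtP hk.
by apply/seq_edgesP; split => // l hl; have := l3 l hl; lia.
Qed.

Lemma seq_edges_node a b k : (a, b) \in seq_edges -> (a < k < b)%N ->
  (forall l, (a < l < b)%N -> (ht k <= ht l)%N) -> lf k = a /\ rt k = b.
Proof.
move=> /seq_edgesP[ab H] akb Hm.
have bn := ltn_ord b; have hk : (0 < k <= n)%N by lia.
have [l1 l2 l3] := lfP hk; have [r1 r2 r3] := rtP hk.
have [h1 h2] := H k akb.
split; apply: val_inj => /=.
  have [lt|gt|//] := ltngtP (lf k) a.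
    by have := l3 a ltac:(lia); lia.
  by have := Hm (lf k) ltac:(lia); lia.
have [lt|gt|//] := ltngtP (rt k) b.
  by have := Hm (rt k) ltac:(lia); lia.
by have := r3 b ltac:(lia); lia.
Qed.

Lemma seq_edges_apex a b : (a, b) \in seq_edges -> (a.+1 < b)%N ->
  exists k, [/\ (a < k < b)%N, lf k = a & rt k = b].
Proof.
move=> abT ab; have bn := ltn_ord b.
have kn : (a.+1 < n.+2)%N by lia.
have [k akb kmin] := @arg_minnP _ (Ordinal kn) (fun c : vertex n => (a < c < b)%N) (fun c => ht c)
  ltac:(by rewrite /= ltnSn ab).
by exists k; have [-> ->] := seq_edges_node abT akb kmin.
Qed.

Lemma root_edge_in : root_edge n \in seq_edges.
Proof.
apply/seq_edgesP; split => // l /andP[l0 ln].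
by rewrite /= ht_max /ht -/(ht l) ht_gt0 // l0 -ltnS.
Qed.

(** Each inner vertex is the apex of a triangle whose base is a diagonal or the root edge. This
    counts the diagonals, and later finds them among the nodes of the dissection. *)
Lemma diagonals_nodes :
  [set (lf (nd i), rt (nd i)) | i : 'I_n]%SET =
  (root_edge n |: (seq_edges :\: polygon_sides n))%SET.
Proof.
apply/setP => -[a b]; rewrite !inE; apply/imsetP/idP => [[i _ e]|].
  have hk := nd_bounds i; have kT := node_base hk; rewrite -e in kT.
  move: (kT); rewrite inE => ->; rewrite andbT.
  have [l1 _ _] := lfP hk; have [r1 _ _] := rtP hk.
  case: e => ea eb; case: eqP => //= _; rewrite orbF ea eb /=.
  by apply/eqP; lia.
have H : (a, b) \in seq_edges -> b != a.+1 :> nat ->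
    exists2 i, i \in 'I_n & (a, b) = (lf (nd i), rt (nd i)).
  move=> abT ab; have [k [h1 <- <-]] := seq_edges_apex abT
    ltac:(by rewrite ltn_neqAle eq_sym ab; case/seq_edgesP: abT).
  have [i <-] : exists i, nd i = k by apply: nd_onto; have := ltn_ord b; lia.
  by exists i.
case/orP => [/eqP e|/andP[/norP[h1 h2] h3]].
  case: e => ea eb; rewrite ea eb in H *.
  by apply: H; [exact: root_edge_in | rewrite /=; lia].
by apply: H => //; rewrite inE.
Qed.

Lemma node_base_inj k k' : (0 < k <= n)%N -> (0 < k' <= n)%N ->
  lf k = lf k' -> rt k = rt k' -> k = k'.
Proof.
move=> hk hk' el er; apply/eqP/negPn/negP => kk'.
have [l1 _ _] := lfP hk; have [r1 _ _] := rtP hk.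
have [l1' _ _] := lfP hk'; have [r1' _ _] := rtP hk'.
have := @node_min k k' hk ltac:(by rewrite el er l1' r1') ltac:(by rewrite eq_sym).
by have := @node_min k' k hk' ltac:(by rewrite -el -er l1 r1) kk'; lia.
Qed.

Lemma seq_edges_triangulation : is_triangulation seq_edges.
Proof.
apply/and4P; split.
- by apply/forallP => -[a b]; apply/implyP => /seq_edgesP[].
- apply/fintype.subsetP => -[a b]; rewrite inE => /orP[/eqP /= e|/eqP ->].
    by apply/seq_edgesP; split; [lia | move=> l; lia].
  exact: root_edge_in.
- apply/forallP => -[a b]; apply/implyP => /seq_edgesP[ab H].
  apply/forallP => -[c d]; apply/implyP => /seq_edgesP[cd H'].
  (* In a crossing [a < c < b < d], each of [c] and [b] would be higher than the other. *)
  apply/negP; rewrite /crossing /= => /andP[acb bd].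
  by have := H c acb; have := H' b ltac:(lia); lia.
- have : #|(root_edge n |: (seq_edges :\: polygon_sides n))%SET| = n.
    rewrite -diagonals_nodes card_imset ?card_ord // => i j [el er].
    have := node_base_inj (nd_bounds i) (nd_bounds j) el er.
    by move=> /(congr1 val) /=; rewrite !val_nd => -[] /val_inj.
  by rewrite cardsU1 !inE eqxx orbT /= add1n => /(congr1 predn) /= ->.
Qed.

Definition seq_triangulation : triangulation n :=
  exist (fun T => is_triangulation T) seq_edges seq_edges_triangulation.
Notation T := seq_triangulation.

(** Another apex [c] is higher than [k], but one of its edges to [a] and [b] spans [k], which would
    then have to be higher than [c]. *)
Lemma apex_seq a b k : (a, b) \in seq_edges -> (a < k < b)%N -> lf k = a -> rt k = b ->
  apex T a b = Some k.
Proof.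
move=> abT akb ka kb; have bn := ltn_ord b; have hk : (0 < k <= n)%N by lia.
rewrite /apex; case: pickP => [c /and3P[acb /seq_edgesP[_ h1] /seq_edgesP[_ h2]]|/(_ k)].
  congr Some; apply/eqP/negPn/negP => ck.
  have := @node_min k c hk ltac:(by rewrite ka kb) ck.
  have [lt|gt|/val_inj e] := ltngtP c k; last by rewrite e eqxx in ck.
    by have := h2 k ltac:(lia); lia.
  by have := h1 k ltac:(lia); lia.
by rewrite akb /= -{1}ka -kb node_left ?node_right.
Qed.

Lemma apex_side a b : (b <= a.+1)%N -> apex T a b = None.
Proof. by move=> ab; rewrite /apex; case: pickP => // c /and3P[h _ _]; lia. Qed.

Lemma mem_nodes_seq m a b (x k y : vertex n) : (a, b) \in seq_edges -> (b <= a + m)%N ->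
  ((x, k, y) \in nodes (dissect T m a b)) = [&& (a < k < b)%N, x == lf k & y == rt k].
Proof.
elim: m a b => [|m IH] a b abT bm; first by case/seq_edgesP: abT; lia.
have [ab|ab] := leqP b a.+1.
  by rewrite /= apex_side //= in_nil; case: ltnP; case: ltnP => //; lia.
have [c [acb la rb]] := seq_edges_apex abT ab.
have bn := ltn_ord b; have hc : (0 < c <= n)%N by lia.
rewrite /= (apex_seq abT acb la rb) /= mem_cat inE.
have acT : (a, c) \in seq_edges by rewrite -la node_left.
have cbT : (c, b) \in seq_edges by rewrite -rb node_right.
rewrite (IH a c acT ltac:(lia)) (IH c b cbT ltac:(lia)).
rewrite !xpair_eqE; have [->|kc] := eqVneq k c.
  by rewrite !ltnn ?andbF /= orbF acb la rb andbT.
have {}kc : k <> c :> nat by move=> /val_inj e; rewrite e eqxx in kc.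
rewrite andbF /=; case: (x == lf k); case: (y == rt k); rewrite ?andbF ?andbT //=.
by apply/idP/idP; lia.
Qed.

Lemma mem_triangle_tree (x k y : vertex n) :
  ((x, k, y) \in nodes (triangle_tree T)) = [&& (0 < k <= n)%N, x == lf k & y == rt k].
Proof. by rewrite mem_nodes_seq ?root_edge_in. Qed.

Lemma kL_seq k : (0 < k <= n)%N -> kL T k = lf k.
Proof.
move=> hk; have [l1 _ _] := lfP hk; rewrite /kL; case: pickP => [j /andP[_]|/(_ (lf k))].
  rewrite inE => /mapP[[[x k'] y]]; rewrite mem_triangle_tree => /and3P[_ /eqP-> _].
  by move=> [-> ->].
rewrite l1 inE => /negP[]; apply/mapP; exists (lf k, k, rt k) => //.
by rewrite mem_triangle_tree hk !eqxx.
Qed.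

Lemma kR_seq k : (0 < k <= n)%N -> kR T k = rt k.
Proof.
move=> hk; have [r1 _ _] := rtP hk; rewrite /kR; case: pickP => [j /andP[_]|/(_ (rt k))].
  rewrite inE => /mapP[[[x k'] y]]; rewrite mem_triangle_tree => /and3P[_ _ /eqP->].
  by move=> [-> ->].
rewrite r1 inE => /negP[]; apply/mapP; exists (lf k, k, rt k) => //.
by rewrite mem_triangle_tree hk !eqxx.
Qed.

(** Vertex [k] corresponds to the entry of index [k.-1], so the vertices strictly between [a] and
    [b] have the indices from [a] to [b - 2]; the apex is the lowest of them, hence the smallest
    entry. *)
Lemma shape_dissect m m' a b : (a, b) \in seq_edges -> (b <= a + m)%N -> (b <= a + m'.+1)%N ->
  Defs.shape (dissect T m a b) = Defs.shape (min_tree m' (take (b - a.+1) (drop a s))).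
Proof.
elim: m m' a b => [|m IH] m' a b abT bm bm'; first by case/seq_edgesP: abT; lia.
have [ab|ab] := leqP b a.+1.
  rewrite /= apex_side // (_ : (b - a.+1)%N = 0%N) ?take0 ?min_tree_nil //; lia.
have [c [acb la rb]] := seq_edges_apex abT ab.
have bn := ltn_ord b; have hc : (0 < c <= n)%N by lia.
have acT : (a, c) \in seq_edges by rewrite -la node_left.
have cbT : (c, b) \in seq_edges by rewrite -rb node_right.
rewrite /= (apex_seq abT acb la rb) /=; case: m' bm' => [|m'] bm'; first by lia.
have sz : size (take (b - a.+1) (drop a s)) = (b - a.+1)%N.
  by rewrite size_takel // size_drop ss; lia.
have mt := @min_tree_argmin m' (take (b - a.+1) (drop a s)) (c - a.+1); rewrite sz in mt.
rewrite mt; [|lia|]; last first.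
  move=> i hi hic; rewrite !nth_take; [|lia..]; rewrite !nth_drop -ltnS -!htS; [|lia..].
  have iv : ((a + i).+1 < n.+2)%N by lia.
  have := @node_min c (Ordinal iv) hc; rewrite la rb /= => /(_ ltac:(lia)).
  rewrite (_ : (a + (c - a.+1)).+1 = c); last by lia.
  by apply; apply/eqP => /(congr1 val) /=; lia.
rewrite /= (IH m') //; [|lia..]; rewrite (IH m') //; [|lia..].
rewrite take_takel; last by lia.
rewrite [drop _ (take _ _)](_ : _ = take (b - c.+1) (drop c s)) //.
have -> : (b - a.+1)%N = ((b - c.+1) + (c - a.+1).+1)%N by lia.
by rewrite -take_drop drop_drop; congr (take _ (drop _ _)); lia.
Qed.

Lemma tree_of_seq : tree_of T = Defs.shape (min_tree n s).
Proof.
rewrite /tree_of /triangle_tree (shape_dissect (m' := n)) ?root_edge_in //.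
by rewrite drop0 /= subn1 /= -ss take_size.
Qed.

(** Trees of the same shape come from the same dissection, so [T'] contains every diagonal of [T],
    as the base of a node; [triangulation_sub_eq] does the rest. *)
Lemma seq_triangulation_unique T' : tree_of T' = Defs.shape (min_tree n s) -> T = T'.
Proof.
rewrite -tree_of_seq => e; apply: triangulation_sub_eq; apply/fintype.subsetP => f fT.
have [/polygon_side_triangulation->//|fns] := boolP (f \in polygon_sides n).
have : f \in (root_edge n |: (seq_edges :\: polygon_sides n))%SET.
  by rewrite in_setU1 finset.in_setD fns fT orbT.
rewrite -diagonals_nodes => /imsetP[i _ ->].
have : (lf (nd i), nd i, rt (nd i)) \in nodes (triangle_tree T).
  by rewrite mem_triangle_tree nd_bounds !eqxx.
rewrite /triangle_tree (@dissect_shape_inj n T T' n.+1 ord0 ord_max) //.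
  apply: nodes_dissect_base; apply: polygon_side_triangulation.
  by rewrite inE eqxx orbT.
rewrite -(size_nodes_shape (dissect _ _ _ _)) -/(triangle_tree T) -/(tree_of T) tree_of_seq.
by rewrite size_nodes_shape size_min_tree ?ss //= subn1.
Qed.

End SequenceTriangulation.

(** * Completeness of the fan of a triangulation *)

Section Reversal.
Local Open Scope ring_scope.
Variables (R : nzRingType) (n : nat).

Definition oprev (x : 'rV[R]_n.+1) : 'rV[R]_n.+1 := \row_j - x 0 (rev_ord j).

Definition crev (x : cquot R n) : cquot R n := cls (oprev (repr x)).

Lemma crev_cls x : crev (cls x) = cls (oprev x).
Proof.
apply/cquot_eqP; have [t ->] := repr_cquot x; exists (- t).
by apply/rowP => j; rewrite !mxE opprD.
Qed.

Lemma crev_is_linear : linear crev.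
Proof.
move=> a; do 2![elim/cquot_ind => ?].
rewrite scale_cls -raddfD !crev_cls scale_cls -raddfD.
by congr cls; apply/rowP => j; rewrite !mxE opprD mulrN.
Qed.

HB.instance Definition _ :=
  GRing.isLinear.Build R (cquot R n) (cquot R n) *:%R crev crev_is_linear.

Lemma oprevK : involutive oprev.
Proof. by move=> x; apply/rowP => j; rewrite !mxE opprK rev_ordK. Qed.

Lemma crevK : involutive crev.
Proof. by elim/cquot_ind => x; rewrite !crev_cls oprevK. Qed.

End Reversal.

Section Completeness.
Local Open Scope ring_scope.
Variables (R : realType) (n : nat) (s : seq nat).
Hypotheses (n0 : (0 < n)%N) (ss : size s = n) (us : uniq s).

Definition varpi_row (i : nat) : 'rV[R]_n.+1 := \row_j (j < i)%N%:R.

Definition sigma_ray (i : 'I_n) (d : bool) : 'rV[R]_n.+1 :=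
  if d then varpi_row (nd i) - varpi_row (rt s (nd i))
  else varpi_row (lf s (nd i)) - varpi_row (nd i).

(** Up to a multiple of one end of the base of the triangle at [k], both branches are [t] times
    [varpi_row k]; the sign of [t] decides which ray gets a nonnegative coefficient. *)
Let signed (i : nat) (t : R) : 'rV[R]_n.+1 :=
  let k : vertex n := inord i in
  if 0 <= t then t *: (varpi_row k - varpi_row (rt s k))
  else - t *: (varpi_row (lf s k) - varpi_row k).

Let signed_decomposition (a b : vertex n) (beta : nat -> R) :
  (a, b) \in seq_edges n s -> exists (c : nat -> R) p q,
  \sum_(a.+1 <= i < b) beta i *: varpi_row i =
  \sum_(a.+1 <= i < b) signed i (c i) + p *: varpi_row a + q *: varpi_row b.
Proof.
have [m] := ubnP (b - a)%N; elim: m a b => // m IH a b bam abT.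
have [ab|ab] := leqP b a.+1.
  by exists (fun=> 0), 0, 0; rewrite !big_geq // !scale0r !addr0.
have [k [akb la rb]] := seq_edges_apex n0 ss us abT ab.
have bn := ltn_ord b; have hk : (0 < k <= n)%N by lia.
have [c1 [p1 [q1 E1]]] := IH a k ltac:(lia) ltac:(by rewrite -la node_left).
have [c2 [p2 [q2 E2]]] := IH k b ltac:(lia) ltac:(by rewrite -rb node_right).
(* The coefficient of [varpi_row k] once both subpolygons have passed on their remainders at [k]. *)
pose g := beta k + q1 + p2.
pose c i := if (i < k)%N then c1 i else if i == k then g else c2 i.
have split_k (F : nat -> 'rV[R]_n.+1) : \sum_(a.+1 <= i < b) F i =
    \sum_(a.+1 <= i < k) F i + (F k + \sum_(k.+1 <= i < b) F i).
  by rewrite (@big_cat_nat _ _ _ k) /=; [rewrite (big_ltn (m := k)) //|..]; lia.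
have cE : \sum_(a.+1 <= i < b) signed i (c i) =
    \sum_(a.+1 <= i < k) signed i (c1 i) + (signed k g + \sum_(k.+1 <= i < b) signed i (c2 i)).
  rewrite split_k; congr (_ + (_ + _)).
  - by apply: eq_big_nat => i /andP[_ ik]; rewrite /c ik.
  - by rewrite /c ltnn eqxx.
  apply: eq_big_nat => i /andP[ki _]; rewrite /c ltnNge (ltnW ki) /=.
  by rewrite gtn_eqF.
exists c; rewrite cE split_k E1 E2 /signed inord_val la rb.
set S1 := \sum_(_ <= _ < k) _; set S2 := \sum_(_ <= _ < b) _.
(* A nonnegative [g] leaves a remainder at [b], a negative one at [a]. *)
have [g0|g0] := leP 0 g.
  exists p1, (q2 + g); rewrite /g; apply/rowP => j; rewrite !mxE; ring.
exists (p1 + g), q2; rewrite /g; apply/rowP => j; rewrite !mxE; ring.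
Qed.

Lemma sigma_complete (x : spaceN R n) : exists (e : 'I_n -> bool) (c : 'I_n -> R),
  (forall k, 0 <= c k) /\ x = \sum_k c k *: cls (sigma_ray k (e k)).
Proof.
elim/cquot_ind: x => x.
pose f i := x 0 (inord i).
(* Summation by parts expands [x] in the rows [varpi_row i], up to a constant row. *)
have xE : x = \sum_(1 <= i < n.+1) (f i.-1 - f i) *: varpi_row i + const_mx (f n).
  apply/rowP => j; rewrite mxE summxE mxE.
  rewrite (@big_cat_nat _ _ _ j.+1) //= big1_seq ?add0r; last first.
    move=> i; rewrite mem_index_iota !mxE => /andP[_ h].
    by rewrite ltnNge -ltnS; case: ltnP => //=; rewrite ?mulr0 //; lia.
  rewrite (eq_big_nat _ _ (F2 := fun i => f i.-1 - f i)); last first.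
    by move=> i /andP[ji _]; rewrite !mxE ji mulr1.
  rewrite big_add1 /= (eq_bigr (fun i => - (f i.+1 - f i))) => [|i _]; last by rewrite opprB.
  rewrite sumrN telescope_sumr; last by rewrite -ltnS.
  by rewrite opprB subrK /f inord_val.
have [c [p [q]]] := signed_decomposition (fun i => f i.-1 - f i) (root_edge_in ss).
rewrite /= => E.
exists (fun i => 0 <= c i.+1), (fun i => `|c i.+1|); split => //.
rewrite sum_scale_cls; apply/cquot_eqP.
exists (q + f n); rewrite [LHS]xE E.
have -> : varpi_row 0 = 0 by apply/rowP => j; rewrite !mxE.
have -> : varpi_row n.+1 = const_mx 1 by apply/rowP => j; rewrite !mxE ltn_ord.
rewrite scaler0 addr0 -addrA; congr (_ + _); last first.
  by apply/rowP => j; rewrite !mxE mulr1.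
rewrite big_add1 /= big_mkord; apply: eq_bigr => i _.
rewrite /signed -/(nd i) /sigma_ray; case: leP => ci; first by rewrite ger0_norm.
by rewrite ltr0_norm.
Qed.

End Completeness.

(** * The isomorphism of fans *)

Section BruhatIntervalFan.
Local Open Scope ring_scope.
Local Open Scope classical_set_scope.
Variables (R : realType) (n : nat) (u : 'S_n).
Hypothesis n0 : (0 < n)%N.
Notation V := (ut u).
Notation U := (seqfun (ut u)).
Notation W := (s_n1 n * ut u)%g.

Definition conj_seq : seq nat := [seq val ((w0 n * u * w0 n)%g i) | i <- enum 'I_n].
Notation s := conj_seq.

Lemma size_conj_seq : size s = n.
Proof. by rewrite size_map size_enum_ord. Qed.

Lemma uniq_conj_seq : uniq s.
Proof.
by rewrite map_inj_uniq ?enum_uniq // => i j /val_inj/perm_inj.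
Qed.

Let ss := size_conj_seq.
Let us := uniq_conj_seq.

(** Conjugation by [w0] reverses positions and values: position [i] becomes vertex [n - i], and
    larger values become lower heights. Position [n], with the largest value, is vertex 0. *)
Lemma seqfun_ut i : (i <= n)%N -> U i = (n - ht s (n - i))%N.
Proof.
rewrite leq_eqVlt => /orP[/eqP->|iN]; first by rewrite U_max subnn /= subn0.
have h : (n - i.+1 < n)%N by lia.
have -> : (n - i = (n - i.+1).+1)%N by lia.
rewrite (htS ss h) /conj_seq (nth_map (Ordinal h)) ?size_enum_ord //.
rewrite -[X in nth _ _ X]/(val (Ordinal h)) nth_ord_enum !permM /w0 !permE /=.
have -> : rev_ord (Ordinal h) = Ordinal iN by apply: val_inj => /=; lia.
have -> : U i = u (Ordinal iN) :> nat.
  rewrite /seqfun /ut (_ : inord i = lift ord_max (Ordinal iN)).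
    by rewrite lift_perm_lift /= /bump leqNgt ltn_ord.
  by apply: val_inj; rewrite /= inordK ?ltnS ?(ltnW iN) // /bump leqNgt iN.
by rewrite -[(_ - _).+1]subSn ?subSS ?subKn // ltnW.
Qed.

Lemma ht_le i : (ht s i <= n)%N.
Proof.
rewrite /ht; case: i => // i; have [h|h] := ltnP i (size s); last first.
  by rewrite [nth _ _ _]nth_default //= size_map.
rewrite /= (nth_map 0%N) //; have := mem_nth 0%N h.
by case/mapP => j _ ->; exact: ltn_ord.
Qed.

Section Node.
Variable i : 'I_n.
Let k := nd i.
(* With 0-based positions, vertex [k] corresponds to position [upos] of [u]; the values
   of [u] on [[uleft, uright)] are at most its value there, and [uleft - 1] and [uright]
   are the nearest positions of larger values. *)
Definition upos : nat := (n - k)%N.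
Definition uleft : nat := (n.+1 - rt s k)%N.
Definition uright : nat := (n - lf s k)%N.

Let hk : (0 < k <= n)%N := nd_bounds i.
Let lk := lfP n0 ss us hk.
Let rk := rtP n0 ss us hk.

Lemma node_bounds : [/\ (uleft <= upos)%N, (upos < uright)%N & (uright <= n)%N].
Proof.
have [l1 _ _] := lk; have [r1 _ _] := rk; have := ltn_ord (rt s k).
by rewrite /uleft /upos /uright; split; lia.
Qed.

Lemma upos_lt : (upos < n)%N.
Proof. by rewrite /upos; lia. Qed.

Lemma U_upos : U upos = (n - ht s k)%N.
Proof. by rewrite seqfun_ut /upos; [rewrite subKn // | ]; lia. Qed.

Lemma U_upos_lt : (U upos < n)%N.
Proof. by rewrite U_upos; have := ht_gt0 ss hk; lia. Qed.

Lemma node_Ul : uleft = 0%N \/ (U upos < U uleft.-1)%N.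
Proof.
have [r1 r2 _] := rk; have rN := ltn_ord (rt s k); have := ht_le k.
(* [rt s k = n.+1] means that no larger value precedes position [upos] in [u]. *)
have [e|ne] := eqVneq (rt s k : nat) n.+1; first by left; rewrite /uleft e subnn.
move=> hn; right; rewrite U_upos seqfun_ut; last by rewrite /uleft; lia.
by rewrite (_ : n - uleft.-1 = rt s k)%N /uleft; lia.
Qed.

Lemma node_Ur : (U upos < U uright)%N.
Proof.
have [l1 l2 _] := lk; have hn := ht_le k.
rewrite U_upos seqfun_ut /uright; last by lia.
by rewrite subKn; lia.
Qed.

Lemma node_Ulow j : (uleft <= j < uright)%N -> (U j <= U upos)%N.
Proof.
move=> hj; have rN := ltn_ord (rt s k); have lN := ltn_ord (lf s k).
rewrite U_upos seqfun_ut; last by move: hj; rewrite /uright; lia.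
have jv : (n - j < n.+2)%N by lia.
have [e|ne] := eqVneq (Ordinal jv) k; first by rewrite -e /=; lia.
have := @node_min n s n0 ss us k (Ordinal jv) hk _ ne.
by rewrite /=; move: hj; rewrite /uleft /uright => hj /(_ ltac:(lia)); lia.
Qed.

Definition upos_ord : 'I_n.+1 := inord upos.

Lemma upos_ordE : upos_ord = upos :> nat.
Proof. by rewrite inordK //; have := upos_lt; lia. Qed.

Lemma V_upos : V upos_ord = U upos :> nat.
Proof. by []. Qed.

Lemma next_larger_upos : next_larger u upos_ord = uright :> nat.
Proof.
have [b1 b2 b3] := node_bounds.
have [h1 h2 h3] := @next_largerP n u upos_ord U_upos_lt.
have nrN : (uright < n.+1)%N by lia.
have := h3 (Ordinal nrN); rewrite upos_ordE V_upos => /(_ b2).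
rewrite -(seqfunE _ (Ordinal nrN)) => /(_ node_Ur) /= le.
apply/eqP; rewrite eqn_leq le /= leqNgt; apply/negP => lt.
have := @node_Ulow (next_larger u upos_ord); rewrite seqfunE.
by rewrite upos_ordE V_upos in h1 h2; lia.
Qed.

End Node.

Definition ind (a b : nat) : 'rV[R]_n.+1 := \row_j (a <= j < b)%N%:R.

Definition fan_ray (i : 'I_n) (d : bool) : 'rV[R]_n.+1 :=
  if d then ind (uleft i) (upos i).+1 else ind (upos i).+1 (uright i).+1.

(** Coordinates of [perm_point] start at 1, whence [.+1]. The right-hand window [(upos i, uright i]]
    is compared with [U] over the window shifted left by one. *)
Definition fan_bound (i : 'I_n) (d : bool) : R :=
  (if d then \sum_(uleft i <= j < (upos i).+1) (U j).+1
   else \sum_(upos i <= j < uright i) (U j).+1)%:R.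

Lemma dot_ind a b (z : 'S_n.+1) : (b <= n.+1)%N ->
  dot (ind a b) (perm_point R z) = (\sum_(a <= j < b) (seqfun z j).+1)%:R.
Proof.
move=> bn; rewrite (big_nat_widen _ _ n.+1) // (@big_nat_widenl _ _ _ a 0) // big_mkord.
rewrite natr_sum [RHS]big_mkcond; apply: eq_bigr => j _.
rewrite !mxE /= seqfunE andbC; case: (_ && _); last by rewrite mul0r.
by rewrite mul1r.
Qed.

Lemma sum_succ (f : nat -> nat) a b :
  (\sum_(a <= j < b) (f j).+1 = \sum_(a <= j < b) f j + (b - a))%N.
Proof.
under eq_bigr do rewrite -addn1.
by rewrite big_split /= sum_nat_const_nat muln1.
Qed.

(** Up to sign, a difference of two rows [varpi_row] is the indicator of an interval; [oprev]
    corrects the sign and reverses the interval into a window of positions of [u]. *)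
Lemma oprev_sigma i d : oprev (sigma_ray R s i d) = fan_ray i d.
Proof.
have [l1 _ _] := lfP n0 ss us (nd_bounds i); have [r1 _ _] := rtP n0 ss us (nd_bounds i).
have rN := ltn_ord (rt s (nd i)); have kN := nd_bounds i.
have B (p q r : bool) : (p -> q) -> r = q && ~~ p ->
    - ((p : nat)%:R - (q : nat)%:R) = (r : nat)%:R :> R.
  by move=> pq ->; case: p q pq => -[] //= pq; rewrite ?subrr ?oppr0 ?sub0r ?opprK //;
     have := pq isT.
apply/rowP => j; have jN := ltn_ord j.
by rewrite /sigma_ray /fan_ray /upos /uleft /uright; case: d; rewrite !mxE; apply: B => /=; lia.
Qed.

Notation Z := [set perm_point R z | z in [set z | bruhat_le V z && bruhat_le z W]].

Lemma fan_bound_le z i d : Z z -> fan_bound i d <= dot (fan_ray i d) z.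
Proof.
move=> [p /andP[vp pw] <-]; have [b1 b2 b3] := node_bounds i.
rewrite /fan_bound /fan_ray; case: d; rewrite dot_ind ?ler_nat ?sum_succ; try lia.
  rewrite leq_add2r.
  exact: (interval_sum_left b1 b2 b3 (node_Ul i) (node_Ur i) (@node_Ulow i) vp pw).
rewrite subSS leq_add2r.
exact: (interval_sum_right b1 b2 b3 (node_Ul i) (node_Ur i) (@node_Ulow i) vp pw).
Qed.

Lemma fan_vertex (e : 'I_n -> bool) : exists2 z, Z z &
  forall i d, dot (fan_ray i d) z = fan_bound i d <-> d = e i.
Proof.
(* The ray for [true] belongs to the left-hand window, so the selected swaps are those with [e i]
   false. *)
pose e' : pred 'I_n.+1 := fun x => [exists i, (upos_ord i == x) && ~~ e i].
have e'E i : e' (upos_ord i) = ~~ e i.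
  apply/existsP/idP => [[j /andP[/eqP]]|]; last by exists i; rewrite eqxx.
  move=> /(congr1 val) /=; rewrite !upos_ordE /upos !val_nd => h.
  suff -> : j = i by [].
  by apply: val_inj => /=; have := ltn_ord i; have := ltn_ord j; lia.
pose p := vtx u e' n.
have vp : bruhat_le V p by apply: vtx_ge.
have pw : bruhat_le p W by apply: vtx_le.
exists (perm_point R p) => [|i]; first by exists p => //=; rewrite vp pw.
have [b1 b2 b3] := node_bounds i; have xn := U_upos_lt i.
have L : e i ->
  (\sum_(uleft i <= j < (upos i).+1) seqfun p j = \sum_(uleft i <= j < (upos i).+1) U j)%N.
  move=> ei; have := @sum_vtx_left n u (upos_ord i) xn e' (uleft i).
  rewrite upos_ordE; apply=> //.
  - exact: node_Ul.
  - by move=> j hj; rewrite -seqfunE; apply: node_Ulow; lia.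
  - by rewrite e'E ei.
have Rt : ~~ e i ->
  (\sum_((upos i).+1 <= j < (uright i).+1) seqfun p j = \sum_(upos i <= j < uright i) U j)%N.
  move=> ei; have := @sum_vtx_right n u (upos_ord i) xn e'.
  by rewrite upos_ordE next_larger_upos; apply; rewrite e'E ei.
have N := interval_sum_not_both b1 b2 b3 (node_Ul i) (node_Ur i) (@node_Ulow i) vp pw.
case; rewrite /fan_ray /fan_bound dot_ind ?sum_succ; try lia; split.
- move/eqP; rewrite eqr_nat eqn_add2r => /eqP h.
  by case ei : (e i) => //; case: N => //; apply: Rt; rewrite ei.
- by move=> ei; rewrite L // -ei.
- move/eqP; rewrite eqr_nat subSS eqn_add2r => /eqP h.
  by case ei : (e i) => //; case: N => //; apply: L; rewrite ei.
- by move=> ei; rewrite subSS Rt // -ei.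
Qed.

Lemma perm_point_sum z : Z z -> \sum_i z 0 i = (\sum_(i < n.+1) i.+1)%:R.
Proof.
move=> [p _ <-]; rewrite natr_sum [RHS](reindex_inj (@perm_inj _ p)) /=.
by apply: eq_bigr => i _; rewrite mxE.
Qed.

Lemma fan_complete (x : spaceN R n) : exists (e : 'I_n -> bool) (c : 'I_n -> R),
  (forall k, 0 <= c k) /\ x = \sum_k c k *: cls (fan_ray k (e k)).
Proof.
have [e [c [c0 E]]] := sigma_complete n0 ss us (crev x).
exists e, c; split => //; rewrite -[LHS]crevK E linear_sum; apply: eq_bigr => i _.
by rewrite linearZ /= crev_cls oprev_sigma.
Qed.

Notation T := (seq_triangulation n0 ss us).

Definition lat_ray (p : 'I_n * bool) : latN n :=
  if p.2 then vvec T (nd p.1) else wvec T (nd p.1).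

Lemma emb_lat_ray p : latN_emb R (lat_ray p) = cls (sigma_ray R s p.1 p.2).
Proof.
case: p => i d; have hk := nd_bounds i.
rewrite /lat_ray /sigma_ray /vvec /wvec /= kL_seq // kR_seq //.
by case: d; rewrite /varpi -raddfB latN_emb_cls; congr cls; apply/rowP => j;
  rewrite !mxE rmorphB /= !natz.
Qed.

Lemma crev_emb (x : latN n) : crev (latN_emb R x) = latN_emb R (crev x).
Proof.
elim/cquot_ind: x => x; rewrite crev_cls !latN_emb_cls crev_cls.
by congr cls; apply/rowP => j; rewrite !mxE rmorphN.
Qed.

Lemma crev_cone (S : set (spaceN R n)) :
  (@crev R n) @` cone_of S = cone_of ((@crev R n) @` S).
Proof.
apply/seteqP; split=> x /=.
  move=> [_ [m [q [c [Sq c0 ->]]]] <-].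
  exists m, (fun i => crev (q i)), c; split => // [i|]; first by exists (q i).
  by rewrite linear_sum; apply: eq_bigr => i _; rewrite linearZ.
move=> [m [q [c [Sq c0 ->]]]].
exists (\sum_i c i *: crev (q i)); last first.
  by rewrite linear_sum; apply: eq_bigr => i _; rewrite linearZ /= crevK.
exists m, (fun i => crev (q i)), c; split => // i.
by have [y Sy <-] := Sq i; rewrite crevK.
Qed.

Lemma normal_fan_interval : normal_fan (bruhat_polytope R V W) =
  [set C | exists I : set ('I_n * bool), (forall k, ~ (I (k, true) /\ I (k, false))) /\
     C = cone_of [set cls (fan_ray p.1 p.2) | p in I]].
Proof.
exact: (normal_fan_cube perm_point_sum fan_bound_le fan_vertex fan_complete).
Qed.

Lemma lat_ray_inj : injective lat_ray.
Proof.
move=> p q pq; apply: (ray_inj perm_point_sum fan_bound_le fan_vertex).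
by rewrite -!oprev_sigma -!crev_cls -!emb_lat_ray pq.
Qed.

(** This indexes the fan by the same label sets as the normal fan. Injectivity of [lat_ray] ensures
    that a label set without opposite labels yields rays that never include both members of a
    pair. *)
Lemma Sigma_seq : Sigma T R =
  [set C | exists I : set ('I_n * bool), (forall k, ~ (I (k, true) /\ I (k, false))) /\
     C = cone_of [set cls (sigma_ray R s p.1 p.2) | p in I]].
Proof.
apply/seteqP; split=> C /=.
  move=> [Q [Qsub Qno ->]]; exists [set p | Q (lat_ray p)]; split.
    by move=> k; exact: (Qno (nd k) (nd_bounds k)).
  congr cone_of; apply/seteqP; split=> x /=.
    move=> [y Qy <-]; have [k [hk yE]] := Qsub y Qy.
    have [i ik] := nd_onto hk; case: yE => yE.
      by exists (i, true); rewrite -?emb_lat_ray /lat_ray /= ik -yE.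
    by exists (i, false); rewrite -?emb_lat_ray /lat_ray /= ik -yE.
  by move=> [p Qp <-]; exists (lat_ray p) => //; rewrite emb_lat_ray.
move=> [I [Ino ->]]; exists [set lat_ray p | p in I]; split.
- move=> _ [[i d] _ <-]; exists (nd i); split; first exact: nd_bounds.
  by rewrite /lat_ray /=; case: d; [left | right].
- move=> k hk; have [i <-] := nd_onto hk; move=> [[p Ip ep] [q Iq eq]].
  have pE : p = (i, true) by apply: lat_ray_inj.
  have qE : q = (i, false) by apply: lat_ray_inj.
  by apply: (Ino i); rewrite -pE -qE.
congr cone_of; apply/seteqP; split=> x /=.
  by move=> [p Ip <-]; exists (lat_ray p); [exists p | rewrite emb_lat_ray].
by move=> [_ [p Ip <-] <-]; exists p => //; rewrite emb_lat_ray.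
Qed.

Lemma crev_fan_cone (I : set ('I_n * bool)) :
  (@crev R n) @` cone_of [set cls (fan_ray p.1 p.2) | p in I] =
  cone_of [set cls (sigma_ray R s p.1 p.2) | p in I].
Proof.
rewrite crev_cone; congr cone_of; apply/seteqP; split=> x /=.
  by move=> [_ [p Ip <-] <-]; exists p => //; rewrite crev_cls -oprev_sigma oprevK.
move=> [p Ip <-]; exists (cls (fan_ray p.1 p.2)); first by exists p.
by rewrite crev_cls -oprev_sigma oprevK.
Qed.

Lemma interval_fan_isomorphic :
  fan_isomorphic (normal_fan (bruhat_polytope R V W)) (Sigma T R).
Proof.
exists (@crev int n), (@crev R n); split.
- by exists (@crev int n); exact: crevK.
- exact: crev_emb.
rewrite normal_fan_interval Sigma_seq; split.
- by move=> _ [I [Ino ->]]; exists I; split => //; exact: crev_fan_cone.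
- move=> C D _ _ E; have K (S : set (spaceN R n)) : (@crev R n) @` ((@crev R n) @` S) = S.
    apply/seteqP; split=> x /=; first by move=> [_ [y Sy <-] <-]; rewrite crevK.
    by move=> Sx; exists (crev x); [exists x | rewrite crevK].
  by rewrite -(K C) E K.
- move=> _ [I [Ino ->]]; exists (cone_of [set cls (fan_ray p.1 p.2) | p in I]).
    by exists I.
  exact: crev_fan_cone.
Qed.

End BruhatIntervalFan.

Theorem theorem7p5 (R : realType) (n : nat) (hn : (1 <= n)%N) (u : 'S_n) :
  exists T : triangulation n,
    unique (fun T' : triangulation n => tree_of T' = psi (w0 n * u * w0 n)%g) T /\
    fan_isomorphic
      (normal_fan (bruhat_polytope R (ut u) (s_n1 n * ut u)%g))
      (Sigma T R).
Proof.
exists (seq_triangulation hn (size_conj_seq u) (uniq_conj_seq u)); split.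
  split; first exact: tree_of_seq.
  by move=> T' ?; exact: seq_triangulation_unique.
exact: interval_fan_isomorphic.
Qed.
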